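(* Let $1\le i\le d$, $q\ge2$ an integer and $p\in[0,1]$. For every box $r$ in $\mathbb{Z}^d$ and every set $\xi$ of $i$-plaquettes of $\mathbb{Z}^d$ (boundary conditions), the measures $\mu^{\xi}_{r,p,q,i}$ and $\mu^{\overline{\xi}}_{r,p,q,i}$ are positively associated. Moreover, any infinite volume plaquette random-cluster measure on $\mathbb{Z}^d$ arising as a weak limit of such finite volume measures (when the limit exists) is positively associated.
   Context: $\mathbb{Z}^d$ denotes the cubical complex on $\mathbb{R}^d$ whose $k$-cells are the $k$-dimensional unit cubes with integer corner points. For a subcomplex $X$, $X^{(k)}$ is the union of its cells of dimension at most $k$; $|X^{(i)}|$ denotes the number of $i$-cells ($i$-plaquettes) of $X$. An $i$-dimensional percolation subcomplex $P$ of $X$ is a subcomplex with $X^{(i-1)}\subset P\subset X^{(i)}$; $|P|$ is its number of $i$-plaquettes. Boxes: for integers $a_k<b_k$, the box $r=\prod_{k=1}^d[a_k,b_k]$, viewed as a complex (for the given $i$), is the union of all cells of dimension at most $i-1$ contained in it and the $i$-cells contained in it that meet its interior. Measures with boundary conditions: for a percolation subcomplex $P$ of $r$ put $P_\xi=P\cup\{\text{plaquettes of }\xi\text{ not in }r\}\cup(\mathbb{Z}^d)^{(i-1)}$ and let $\phi:P\to P_\xi$ be the inclusion. With $\phi^*:H^{i-1}(P_\xi;\mathbb{Z}_q)\to H^{i-1}(P;\mathbb{Z}_q)$, $\mathbb{Z}_q=\mathbb{Z}/q\mathbb{Z}$, $$\mu^{\xi}_{r,p,q,i}(P)\propto p^{|P|}(1-p)^{|r^{(i)}|-|P|}\,|\mathrm{im}\,\phi^*|.$$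 Borel--Moore homology $H_k^{\mathrm{BM}}(X;\mathbb{Z}_q)$ is the homology of the complex of locally finite chains: $C_k^{\mathrm{BM}}(X;\mathbb{Z}_q)$ consists of all formal, possibly infinite, sums $\sum_\sigma a_\sigma\sigma$ over $k$-cells of $X$, with the usual boundary operator extended linearly. With $\phi_*^{\mathrm{BM}}:H_{i-1}^{\mathrm{BM}}(P;\mathbb{Z}_q)\to H_{i-1}^{\mathrm{BM}}(P_\xi;\mathbb{Z}_q)$ induced by $\phi$, $$\mu^{\overline{\xi}}_{r,p,q,i}(P)\propto p^{|P|}(1-p)^{|r^{(i)}|-|P|}\,|\mathrm{im}\,\phi_*^{\mathrm{BM}}|.$$ A measure $\mu$ on percolation subcomplexes is positively associated if $\mu(A\cap B)\ge\mu(A)\mu(B)$ for all increasing events $A,B$, where $A$ is increasing if $P\in A$ and $P\subset P'$ imply $P'\in A$. Weak limits are taken along boxes increasing to $\mathbb{Z}^d$, in the sense of convergence of probabilities of all events depending on finitely many plaquettes. *)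

(* Defs.v *)
From mathcomp Require Import all_boot all_order all_algebra finmap.
From mathcomp Require Import all_classical all_reals all_analysis.

Set Implicit Arguments.
Unset Strict Implicit.
Unset Printing Implicit Defensive.

Import Order.TTheory GRing.Theory Num.Theory.
Import numFieldNormedType.Exports.

Local Open Scope classical_set_scope.
Local Open Scope ring_scope.

(* [(m, D)] encodes the cube that is [m_j, m_j + 1] in the directions j \in D
   and {m_j} in the others. *)
Definition cell (d : nat) : Type := ({ffun 'I_d -> int} * {set 'I_d})%type.

Definition cell_dim d (s : cell d) : nat := #|s.2|.
Definition lo d (s : cell d) (j : 'I_d) : int := s.1 j.
Definition hi d (s : cell d) (j : 'I_d) : int := s.1 j + (j \in s.2)%:R.

(* The faces of a cube are the cells contained in it. *)
Definition face d (t s : cell d) : Prop :=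
  forall j, lo s j <= lo t j /\ hi t j <= hi s j.

Definition subcomplex d (P X : set (cell d)) : Prop :=
  P `<=` X /\ forall s t, P s -> face t s -> P t.

Definition skeleton d (k : nat) (X : set (cell d)) : set (cell d) :=
  [set s | X s /\ (cell_dim s <= k)%N].

Definition plaquettes d (i : nat) (X : set (cell d)) : set (cell d) :=
  [set s | X s /\ cell_dim s = i].

Definition num_plaquettes d (i : nat) (X : set (cell d)) : nat :=
  #|` fset_set (plaquettes i X)|.

Definition percolation_subcomplexes d (i : nat) (X : set (cell d)) :
    set (set (cell d)) :=
  [set P | [/\ subcomplex P X, skeleton i.-1 X `<=` P & P `<=` skeleton i X]].

Record box (d : nat) := Box {
  lower : 'I_d -> int;
  upper : 'I_d -> int;
  lower_lt_upper : forall k, lower k < upper k }.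

Definition in_box d (r : box d) (s : cell d) : Prop :=
  forall k, lower r k <= lo s k /\ hi s k <= upper r k.

(* The cell and the open box are products of intervals, and a closed interval
   [u, v] meets an open interval ]a, b[ with a < b iff u < b and a < v. *)
Definition meets_interior d (r : box d) (s : cell d) : Prop :=
  forall k, lo s k < upper r k /\ lower r k < hi s k.

Definition box_complex d (i : nat) (r : box d) : set (cell d) :=
  [set s | in_box r s /\
     ((cell_dim s <= i.-1)%N \/ cell_dim s = i /\ meets_interior r s)].

(* The front (b = true) and back (b = false) facets of s in direction j. *)
Definition facet d (s : cell d) (j : 'I_d) (b : bool) : cell d :=
  ([ffun l => s.1 l + (b && (l == j))%:R], s.2 :\ j).

(* [bd q s t] is the coefficient of t in the cubical boundary of s. *)
Definition bd d q (s t : cell d) : 'Z_q :=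
  \sum_(j in s.2) (-1) ^+ #|[set l in s.2 | (l < j)%N]| *
     ((t == facet s j true)%:R - (t == facet s j false)%:R).

(* A function on cells stands both for a cochain and for a possibly infinite
   formal sum of cells. Both are extended by zero outside the cells of X of the
   given degree; degrees are integers so that there are no nonzero (co)chains
   of degree -1. *)
Definition chain d q : Type := cell d -> 'Z_q.

Definition chains d q (k : int) (X : set (cell d)) : set (chain d q) :=
  [set c | forall s, c s != 0 -> X s /\ (cell_dim s)%:Z = k].

Definition restriction d q (X : set (cell d)) (c : chain d q) : chain d q :=
  patch (fun=> 0) X c.

(* The sums below have finite support, since a cell has finitely many facets
   and is a facet of finitely many cells. *)
Definition coboundary d q (X : set (cell d)) (f : chain d q) : chain d q :=
  restriction X (fun s => \sum_(t \in [set: cell d]) f t * bd q s t).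

Definition boundary d q (c : chain d q) : chain d q :=
  fun t => \sum_(s \in [set: cell d]) c s * bd q s t.

Definition chain_coset d q (B : set (chain d q)) (z : chain d q) :
    set (chain d q) :=
  [set z + b | b in B].

Definition chain_quotient d q (Z B : set (chain d q)) :
    set (set (chain d q)) :=
  [set chain_coset B z | z in Z].

(* The map induced by u from cosets to cosets of B. *)
Definition coset_map d q (u : chain d q -> chain d q) (B : set (chain d q))
    (h : set (chain d q)) : set (chain d q) :=
  [set u z + b | z in h & b in B].

Definition cocycles d q (k : int) (X : set (cell d)) : set (chain d q) :=
  [set f | chains k X f /\ coboundary X f = 0].

Definition coboundaries d q (k : int) (X : set (cell d)) : set (chain d q) :=
  coboundary X @` chains (k - 1) X.

Definition cohomology d q (k : int) (X : set (cell d)) :=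
  @chain_quotient d q (cocycles k X) (coboundaries k X).

Definition pullback d q (k : int) (X : set (cell d)) :
    set (chain d q) -> set (chain d q) :=
  coset_map (restriction X) (coboundaries k X).

Definition BM_cycles d q (k : int) (X : set (cell d)) : set (chain d q) :=
  [set c | chains k X c /\ boundary c = 0].

Definition BM_boundaries d q (k : int) (X : set (cell d)) : set (chain d q) :=
  @boundary d q @` chains (k + 1) X.

Definition BM_homology d q (k : int) (X : set (cell d)) :=
  @chain_quotient d q (BM_cycles k X) (BM_boundaries k X).

(* Chains being extended by zero, the inclusion into Y acts as the identity. *)
Definition BM_pushforward d q (k : int) (Y : set (cell d)) :
    set (chain d q) -> set (chain d q) :=
  coset_map id (BM_boundaries k Y).

Definition with_boundary d (i : nat) (r : box d) (xi P : set (cell d)) :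
    set (cell d) :=
  P `|` (xi `\` box_complex i r) `|` skeleton i.-1 [set: cell d].

Definition card_im_cohomology d (q i : nat) (r : box d) (xi P : set (cell d))
    : nat :=
  let k := i%:Z - 1 in
  #|` fset_set
        (@pullback d q k P @` @cohomology d q k (with_boundary i r xi P))|.

Definition card_im_BM_homology d (q i : nat) (r : box d) (xi P : set (cell d))
    : nat :=
  let k := i%:Z - 1 in
  #|` fset_set
        (@BM_pushforward d q k (with_boundary i r xi P) @` @BM_homology d q k P)|.

Definition bernoulli_weight (R : realType) d (p : R) (i : nat) (r : box d)
    (P : set (cell d)) : R :=
  p ^+ num_plaquettes i P *
  (1 - p) ^+ (num_plaquettes i (box_complex i r) - num_plaquettes i P).

(* The probability measure on the finite set Omega proportional to w. *)
Definition normalized (R : realType) (T : choiceType) (Omega : set T)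
    (w : T -> R) (A : set T) : \bar R :=
  ((\sum_(P \in Omega `&` A) w P) / (\sum_(P \in Omega) w P))%:E.

Definition prcm (R : realType) d (p : R) (q i : nat) (r : box d)
    (xi : set (cell d)) : set (set (cell d)) -> \bar R :=
  normalized (percolation_subcomplexes i (box_complex i r))
    (fun P => bernoulli_weight p i r P * (card_im_cohomology q i r xi P)%:R).

Definition prcm_BM (R : realType) d (p : R) (q i : nat) (r : box d)
    (xi : set (cell d)) : set (set (cell d)) -> \bar R :=
  normalized (percolation_subcomplexes i (box_complex i r))
    (fun P => bernoulli_weight p i r P * (card_im_BM_homology q i r xi P)%:R).

Definition increasing d (Omega A : set (set (cell d))) : Prop :=
  forall P P', A P -> Omega P' -> P `<=` P' -> A P'.

(* Omega is the sample space, [events] the sigma-algebra. *)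
Definition positively_associated (R : realType) d
    (Omega : set (set (cell d))) (events : set (set (set (cell d))))
    (mu : set (set (cell d)) -> \bar R) : Prop :=
  forall A B, events A -> events B -> A `<=` Omega -> B `<=` Omega ->
    increasing Omega A -> increasing Omega B ->
    (mu A * mu B <= mu (A `&` B))%E.

(* Sets of cells, with the sigma-algebra generated by the events {s \in P}. *)
Definition configurations (d : nat) :=
  g_sigma_algebraType
    (range (fun s : cell d => [set P : set (cell d) | P s])).

Definition depends_on_finitely_many d (i : nat) (A : set (set (cell d)))
    : Prop :=
  exists S : set (cell d),
    [/\ finite_set S, S `<=` plaquettes i [set: cell d] &
        forall P P', P `&` S = P' `&` S -> A P -> A P'].

(* The sample space of mu consists of the percolation subcomplexes of Z^d. *)
Definition weak_limit (R : realType) d (i : nat)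
    (nu : nat -> set (set (cell d)) -> \bar R)
    (mu : probability (configurations d) R) : Prop :=
  mu (percolation_subcomplexes i [set: cell d]) = 1%E /\
  forall A : set (set (cell d)), depends_on_finitely_many i A ->
    nu n A @[n --> \oo] --> mu A.

Definition increasing_to_Zd d (r : nat -> box d) : Prop :=
  (forall n s, in_box (r n) s -> in_box (r n.+1) s) /\
  (forall s : cell d, exists n, in_box (r n) s).

(* Main.v *)
Require Import Defs.
From mathcomp Require Import all_boot all_order all_algebra finmap.
From mathcomp Require Import all_classical all_reals all_analysis.
From mathcomp Require Import lra ring zify.

(* In finite volume, by the FKG inequality, it suffices that the cardinality
   N(P) of the image is log-supermodular, the Bernoulli weight being
   log-modular.
   Cohomology: N(P) is, up to a factor independent of P, the number of
   (i-1)-cochains of the box that extend to cocycles of P_xi. These groups K(P)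
   satisfy K(P u P') = K(P) n K(P') and K(P) + K(P') <= K(P n P'), and
   |K||K'| = |K + K'||K n K'|. Borel-Moore homology: N(P) = |Z| / |G(P)|, where Z
   is the group of (i-1)-cycles of the box and G(P) that of those bounding in
   P_xi; here G(P u P') = G(P) + G(P') and G(P n P') <= G(P) n G(P').

   In infinite volume, increasing events A and B are approximated from inside by
   closed sets F and G, the law being inner regular. By compactness the
   upward closure of F is closed, so it is a decreasing limit of increasing
   cylinder events, to which weak convergence applies; and it stays inside A. *)

Import Order.TTheory GRing.Theory Num.Theory.
Import numFieldNormedType.Exports.

Set Implicit Arguments.
Unset Strict Implicit.
Unset Printing Implicit Defensive.

Local Open Scope classical_set_scope.
Local Open Scope ring_scope.

Local Notation ncard A := #|` fset_set A|.

(** * The FKG inequality *)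

(** Four functions theorem over a single point, index 1 meaning that the point is present. Both
    mixed products [a0 * b1] and [a1 * b0] are bounded by [c1 * d0], which occurs only once on the
    right; the bound [ab] on their product makes up for this. *)
Lemma four_functions_two_point (R : realFieldType)
    (a0 a1 b0 b1 c0 c1 d0 d1 : R) :
  0 <= a0 -> 0 <= a1 -> 0 <= b0 -> 0 <= b1 ->
  0 <= c0 -> 0 <= c1 -> 0 <= d0 -> 0 <= d1 ->
  a0 * b0 <= c0 * d0 -> a0 * b1 <= c1 * d0 ->
  a1 * b0 <= c1 * d0 -> a1 * b1 <= c1 * d1 ->
  (a0 + a1) * (b0 + b1) <= (c0 + c1) * (d0 + d1).
Proof.
move=> a00 a10 b00 b10 c00 c10 d00 d10 h00 h01 h10 h11.
(* The factor [c1 * d0] is cancelled in [mid], so its vanishing is treated apart. *)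
have [z|nz] := eqVneq (c1 * d0) 0.
  rewrite z in h01 h10.
  have : 0 <= c0 * d1 by exact: mulr_ge0.
  nra.
have cpos : 0 < c1 * d0 by rewrite lt_def nz mulr_ge0.
(* With c = c1 d0, the product (c - a0 b1) (c - a1 b0) is nonnegative. *)
have ab : (a0 * b1) * (a1 * b0) <= (c1 * d0) * (c0 * d1).
  have -> : (a0 * b1) * (a1 * b0) = (a0 * b0) * (a1 * b1) by ring.
  have -> : (c1 * d0) * (c0 * d1) = (c0 * d0) * (c1 * d1) by ring.
  by apply: ler_pM => //; apply: mulr_ge0.
have mid : a0 * b1 + a1 * b0 <= c1 * d0 + c0 * d1.
  rewrite -(ler_pM2l cpos).
  have : 0 <= (c1 * d0 - a0 * b1) * (c1 * d0 - a1 * b0).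
    by rewrite mulr_ge0 // subr_ge0.
  nra.
nra.
Qed.

(** Subsets of [a |: S] come in pairs [x] and [a |: x]; this removes one element from the ground set
    in the induction for the four functions theorem. *)
Lemma big_powersetU1 (R : nmodType) (T : finType) (a : T) (S : {set T})
    (f : {set T} -> R) : a \notin S ->
  \sum_(x in powerset (a |: S)) f x =
  \sum_(x in powerset S) (f x + f (a |: x)).
Proof.
move=> aS; rewrite (bigID (fun x : {set T} => a \in x)) /= addrC big_split /=.
congr (_ + _).
  apply: eq_bigl => x; rewrite !powersetE.
  apply/andP/idP => [[xS ax]|xS].
    by rewrite -(setU1K aS) finset.subsetD1 xS.
  by rewrite (fintype.subset_trans xS (finset.subsetUr _ _))
    (contra (fintype.subsetP xS a)).
rewrite (reindex_onto (fun x => a |: x) (fun x => x :\ a)) /=.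
  apply: eq_bigl => x; rewrite !powersetE setU11 andbT.
  apply/andP/idP => [[xS /eqP <-]|xS].
    by rewrite -(setU1K aS) finset.setSD.
  have ax : a \notin x by rewrite (contra (fintype.subsetP xS a)).
  by rewrite finset.setUS // setU1K.
by move=> x /andP[_ ax]; rewrite finset.setD1K.
Qed.

(* Ahlswede-Daykin *)
Lemma four_functions (R : realFieldType) (T : finType) (S : {set T})
    (f g h k : {set T} -> R) :
  (forall x, 0 <= f x) -> (forall x, 0 <= g x) ->
  (forall x, 0 <= h x) -> (forall x, 0 <= k x) ->
  (forall x y : {set T}, x \subset S -> y \subset S ->
     f x * g y <= h (x :|: y) * k (x :&: y)) ->
  (\sum_(x in powerset S) f x) * (\sum_(x in powerset S) g x) <=
  (\sum_(x in powerset S) h x) * (\sum_(x in powerset S) k x).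
Proof.
have [n] := ubnP #|S|; elim: n S f g h k => // n IHn S f g h k Sn f0 g0 h0 k0 H.
have [->|/set0Pn[a aS]] := eqVneq S finset.set0.
  rewrite powerset0 !big_set1.
  by have := H finset.set0 finset.set0; rewrite finset.setUid finset.setIid
    !finset.sub0set; exact.
rewrite -(finset.setD1K aS); set S' := S :\ a.
have aS' : a \notin S' by rewrite !inE eqxx.
rewrite !big_powersetU1 //.
(* The induction hypothesis is applied to the functions sending [x] to [f x + f (a |: x)], and
   likewise for [g], [h], [k]; what they must satisfy is the two-point case. *)
apply: IHn => [|x|x|x|x|x y xS yS]; try exact: addr_ge0.
  by rewrite -ltnS (leq_trans _ Sn) // ltnS [X in (_ < X)%N](cardsD1 a) aS.
have sub (z : {set T}) : z \subset S' -> (z \subset S) && (a |: z \subset S).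
  move=> zS; have zS2 : z \subset S by rewrite (fintype.subset_trans zS) ?subsetDl.
  by rewrite zS2 finset.subUset finset.sub1set aS.
have [xSS axS] := andP (sub _ xS); have [ySS ayS] := andP (sub _ yS).
have nota (z : {set T}) : z \subset S' -> a \notin z.
  by move=> zS; rewrite (contra (fintype.subsetP zS a)).
have disj (z t : {set T}) : a \notin z -> z :&: (a |: t) = z :&: t.
  move=> az; apply/finset.setP => u; rewrite !inE.
  by have [->|] := eqVneq u a; rewrite ?(negPf az).
apply: four_functions_two_point => //.
- exact: H.
- have := H x (a |: y) xSS ayS.
  by rewrite finset.setUCA disj ?nota.
- have := H (a |: x) y axS ySS.
  by rewrite -finset.setUA finset.setIC disj ?nota // finset.setIC.
- have := H (a |: x) (a |: y) axS ayS.
  by rewrite -finset.setUUr -finset.setUIr.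
Qed.

(** Bridge from the finite lattice [{set X}], where the four functions theorem lives, to classical
    sets such as subcomplexes; it respects unions and intersections. *)
Definition set_of_subfinset (T : choiceType) (X : {fset T}) (x : {set X}) : set T :=
  [set t | exists2 u : X, u \in x & val u = t].

Lemma set_of_subfinset_inj (T : choiceType) (X : {fset T}) :
  injective (@set_of_subfinset T X).
Proof.
move=> x y xy; apply/finset.setP => u; apply/idP/idP => ux.
  have : set_of_subfinset y (val u) by rewrite -xy; exists u.
  by case=> v vy /val_inj <-.
have : set_of_subfinset x (val u) by rewrite xy; exists u.
by case=> v vy /val_inj <-.
Qed.

Lemma set_of_subfinsetU (T : choiceType) (X : {fset T}) (x y : {set X}) :
  set_of_subfinset (x :|: y) = set_of_subfinset x `|` set_of_subfinset y.
Proof.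
apply/seteqP; split=> t.
  by case=> u; rewrite inE => /orP[] ux <-; [left|right]; exists u.
by case=> -[u ux <-]; exists u => //; rewrite inE ux ?orbT.
Qed.

Lemma set_of_subfinsetI (T : choiceType) (X : {fset T}) (x y : {set X}) :
  set_of_subfinset (x :&: y) = set_of_subfinset x `&` set_of_subfinset y.
Proof.
apply/seteqP; split=> t.
  by case=> u; rewrite inE => /andP[ux uy] <-; split; exists u.
by case=> -[u ux <-] [v vy /val_inj vu]; exists u => //; rewrite inE ux -vu.
Qed.

Lemma set_of_subfinset_surj (T : choiceType) (X : set T) (P : set T) :
  finite_set X -> P `<=` X -> exists x : {set fset_set X}, set_of_subfinset x = P.
Proof.
move=> finX PX; exists [set u : fset_set X | `[<P (val u)>]]%SET.
apply/seteqP; split=> t.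
  by case=> u; rewrite inE => /asboolP Pu <-.
move=> Pt; have tX : t \in fset_set X by rewrite in_fset_set // inE; exact: PX.
by exists [` tX]%fset => //; rewrite inE; apply/asboolP.
Qed.

(** Extending the weight by zero outside [Omega] turns the sum into one over a full power set, as
    the four functions theorem requires. *)
Lemma sum_set_of_subfinset (R : nmodType) (T : choiceType) (X : {fset T})
    (Omega : set (set T)) (w : set T -> R) :
  (forall P, Omega P -> P `<=` [set` X]) ->
  \sum_(P \in Omega) w P =
  \sum_(x in powerset [set: X])
    (if `[<Omega (set_of_subfinset x)>] then w (set_of_subfinset x) else 0).
Proof.
move=> OX; rewrite -big_mkcondr /=.
pose Q := [set x : {set X} | Omega (set_of_subfinset x)].
have OE : Omega = @set_of_subfinset T X @` Q.
  apply/seteqP; split=> [P OP|_ [x Qx <-]//].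
  have [|x xP] := @set_of_subfinset_surj T [set` X] P _ (OX P OP).
    exact: finite_fset.
  rewrite set_fsetK in x xP.
  by exists x => //; rewrite /Q /= xP.
rewrite [in LHS]OE fsbig_image; last by move=> x y _ _; exact: set_of_subfinset_inj.
rewrite [RHS](eq_bigl (fun x => x \in Q)); last first.
  move=> x; rewrite powersetE finset.subsetT.
  by apply/asboolP/idP => [OP|/set_mem //]; exact: mem_set.
by rewrite [RHS]bigfs ?index_enum_uniq ?set_mem_set // => x _; rewrite mem_index_enum.
Qed.

(* FKG *)
Lemma positively_associated_normalized (R : realType) d
    (Omega : set (set (cell d))) (X : set (cell d)) (w : set (cell d) -> R) :
  finite_set X -> (forall P, Omega P -> P `<=` X) ->
  (forall P P', Omega P -> Omega P' -> Omega (P `|` P') /\ Omega (P `&` P')) ->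
  (forall P, Omega P -> 0 <= w P) ->
  (forall P P', Omega P -> Omega P' ->
     w P * w P' <= w (P `|` P') * w (P `&` P')) ->
  positively_associated Omega setT (normalized Omega w).
Proof.
move=> finX OX lat w0 wS A B _ _ AO BO incA incB.
pose K := fset_set X.
have OK P : Omega P -> P `<=` [set` K] by rewrite fset_setK //; exact: OX.
pose s C := \sum_(P \in Omega `&` C) w P.
have sum_ge0 C : 0 <= s C by apply: fsumr_ge0 => P [OP _]; exact: w0.
(* The four functions are the weight cut off to [A], to [B], to their intersection and to all of
   [Omega]. Since both events are increasing, the union of a member of [A] and a member of [B] lies
   in both. *)
have key : s A * s B <= s (A `&` B) * s setT.
  have ite0 C P : 0 <= if `[<(Omega `&` C) P>] then w P else 0.
    by case: asboolP => // -[/w0].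
  rewrite /s !(@sum_set_of_subfinset _ _ K);
    try (by move=> P [OP _]; exact: OK).
  apply: four_functions => [x|x|x|x|x y _ _]; try exact: ite0.
  rewrite set_of_subfinsetU set_of_subfinsetI.
  move: (set_of_subfinset x) (set_of_subfinset y) => P P'.
  case: asboolP => [[OP AP]|_]; last by rewrite mul0r mulr_ge0 ?ite0.
  case: asboolP => [[OP' BP']|_]; last by rewrite mulr0 mulr_ge0 ?ite0.
  have [OU OI] := lat _ _ OP OP'.
  rewrite !asboolT //; first exact: wS.
  split=> //; split.
    by apply: (incA P) => //; exact: subsetUl.
  by apply: (incB P') => //; exact: subsetUr.
rewrite /normalized -EFinM lee_fin -/(s A) -/(s B) -/(s (A `&` B)).
have -> : \sum_(P \in Omega) w P = s setT by rewrite /s setIT.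
(* If the total weight is zero, division by zero gives 0 and every probability vanishes. *)
rewrite mulf_div; have [->|nz] := eqVneq (s setT) 0.
  by rewrite mul0r invr0 !mulr0.
rewrite ler_pdivrMr ?lt_def ?mulf_neq0 ?mulr_ge0 //.
by rewrite mulrA divfK.
Qed.

(** * Cardinalities of finite subgroups *)

Lemma ncard_image (T U : choiceType) (f : T -> U) (A : set T) :
  finite_set A -> set_inj A f -> ncard (f @` A) = ncard A.
Proof.
move=> finA injf; rewrite fset_set_image // card_in_imfset //= => x y.
by rewrite !in_fset_set //; exact: injf.
Qed.

Lemma ncard_fibers (T U : choiceType) (f : T -> U) (A : set T) (k : nat) :
  finite_set A ->
  (forall x, A x -> ncard (A `&` [set y | f y = f x]) = k) ->
  ncard A = (ncard (f @` A) * k)%N.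
Proof.
move=> finA fib; rewrite card_fset_sum1 (@partition_big_imfset _ _ _ _ _ f) /=.
rewrite fset_set_image // card_fset_sum1 big_distrl /= big_seq [RHS]big_seq.
apply: eq_bigr => u /imfsetP[x /=]; rewrite in_fset_set // inE => Ax ->.
rewrite mul1n -(fib x Ax) card_fset_sum1 big_fset_condE /=.
apply: eq_fbigl => y; rewrite !inE in_fset_set; last exact: finite_setIl.
rewrite in_fset_set //; apply/andP/idP; rewrite !inE.
  by move=> [Ay /eqP].
by move=> [Ay /= /eqP].
Qed.

Definition subgroup_set (V : zmodType) (G : set V) : Prop :=
  G 0 /\ forall x y, G x -> G y -> G (x - y).

Lemma subgroup_setN (V : zmodType) (G : set V) x :
  subgroup_set G -> G x -> G (- x).
Proof. by move=> [G0 GB] Gx; rewrite -sub0r; exact: GB. Qed.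

Lemma subgroup_setD (V : zmodType) (G : set V) x y :
  subgroup_set G -> G x -> G y -> G (x + y).
Proof.
move=> sG Gx Gy; rewrite -[y]opprK; apply: sG.2 => //; exact: subgroup_setN.
Qed.

Lemma subgroup_setI (V : zmodType) (G H : set V) :
  subgroup_set G -> subgroup_set H -> subgroup_set (G `&` H).
Proof.
move=> [G0 GB] [H0 HB]; split=> // x y [Gx Hx] [Gy Hy].
by split; [exact: GB|exact: HB].
Qed.

(** The fibre of [f] through [x] is the translate by [x] of the intersection of [G] and [K]. The map
    [f] need not be a homomorphism: later its values are cosets, which are mere sets. *)
Lemma ncard_quotient (V : zmodType) (U : choiceType) (G K : set V)
    (f : V -> U) : finite_set G -> subgroup_set G ->
  (forall x y, G x -> G y -> f y = f x <-> K (y - x)) ->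
  ncard G = (ncard (f @` G) * ncard (G `&` K))%N.
Proof.
move=> finG sG fK; apply: ncard_fibers => // x Gx.
have -> : G `&` [set y | f y = f x] = +%R x @` (G `&` K).
  apply/seteqP; split=> [y [Gy /= /fK Ky]|_ [z [Gz Kz] <-]].
    exists (y - x); last by rewrite addrC subrK.
    by split; [exact: sG.2|exact: Ky].
  have Gxz := subgroup_setD sG Gx Gz.
  by split=> //=; apply/fK => //; rewrite addrAC subrr add0r.
apply: ncard_image; first exact: finite_setIl.
by move=> y z _ _ /addrI.
Qed.

Definition sum_set (V : zmodType) (G H : set V) : set V :=
  [set g + h | g in G & h in H].

(** Addition maps the product of [G] and [H] onto their sum, and its kernel, the pairs [(g, - g)],
    is a copy of the intersection. *)
Lemma ncard_sum_set (V : zmodType) (G H : set V) :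
  finite_set G -> finite_set H -> subgroup_set G -> subgroup_set H ->
  (ncard (sum_set G H) * ncard (G `&` H) = ncard G * ncard H)%N.
Proof.
move=> finG finH sG sH.
have finGH : finite_set (G `*` H) by exact: finite_setX.
have sGH : @subgroup_set (V * V)%type (G `*` H).
  split; first by split; [exact: sG.1|exact: sH.1].
  by move=> x y [? ?] [? ?]; split; [exact: sG.2|exact: sH.2].
have <- : ncard (G `*` H) = (ncard G * ncard H)%N.
  rewrite (@ncard_fibers _ _ fst _ (ncard H)) // => [|[g h] [/= Gg _]].
    congr (ncard _ * _)%N; apply/seteqP; split=> [_ [x [Gx _] <-]//|g Gg].
    by exists (g, 0) => //; split=> //; exact: sH.1.
  rewrite -(@ncard_image _ _ (pair g) H) //; last by move=> x y _ _ [].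
  congr (ncard _); apply/seteqP; split=> [[g' h'] [[/= _ Hh'] <-]|_ [h' Hh' <-]//].
  by exists h'.
rewrite (@ncard_quotient (V * V)%type V (G `*` H) [set x | x.1 + x.2 = 0]
  (fun x => x.1 + x.2)) //; last first.
  move=> x y _ _; rewrite /=; split=> [e|].
    by rewrite addrACA e -opprD subrr.
  by rewrite addrACA -opprD => /subr0_eq.
congr (_ * _)%N.
  congr (ncard _); apply/seteqP; split=> x.
    by case=> g Gg [h Hh <-]; exists (g, h).
  by case=> -[g h] [/= Gg Hh] <-; exists g => //; exists h.
have -> : (G `*` H) `&` [set x | x.1 + x.2 = 0] =
    (fun x => (x, - x)) @` (G `&` H).
  apply/seteqP; split=> [[g h] [[/= Gg Hh] /eqP gh]|_ [g [Gg Hg] <-]].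
    have hg : h = - g by apply/eqP; rewrite -addr_eq0 addrC.
    rewrite hg in Hh *; exists g => //; split=> //.
    by rewrite -[g]opprK; exact: subgroup_setN.
  by split; [split=> //; exact: subgroup_setN|rewrite /= subrr].
rewrite ncard_image //; last by move=> x y _ _ [].
exact: finite_setIl.
Qed.

Lemma leq_ncard (T : choiceType) (A B : set T) :
  finite_set B -> A `<=` B -> (ncard A <= ncard B)%N.
Proof.
move=> finB AB; apply: fsubset_leq_card.
by rewrite -fset_set_sub //; exact: sub_finite_set finB.
Qed.

Lemma ncard_gt0 (T : choiceType) (A : set T) (x : T) :
  finite_set A -> A x -> (0 < ncard A)%N.
Proof.
move=> finA Ax; rewrite cardfs_gt0; apply/fset0Pn.
by exists x; rewrite in_fset_set ?inE.
Qed.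

Lemma finite_sum_set (V : zmodType) (G H : set V) :
  finite_set G -> finite_set H -> finite_set (sum_set G H).
Proof. exact: finite_image2. Qed.

(** The product formula with intersection and sum enlarged, as needed for cohomology. *)
Lemma ncard_mul_le (V : zmodType) (G H M N : set V) :
  finite_set G -> finite_set H -> finite_set N ->
  subgroup_set G -> subgroup_set H ->
  G `&` H `<=` M -> finite_set M -> sum_set G H `<=` N ->
  (ncard G * ncard H <= ncard M * ncard N)%N.
Proof.
move=> finG finH finN sG sH GHM finM GHN.
by rewrite -(ncard_sum_set finG finH sG sH) [leqLHS]mulnC leq_mul ?leq_ncard.
Qed.

(** The product formula with intersection and sum shrunk, as needed for Borel-Moore homology, where
    the groups are in the denominator. *)
Lemma ncard_mul_ge (V : zmodType) (G H M N : set V) :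
  finite_set G -> finite_set H ->
  subgroup_set G -> subgroup_set H ->
  M `<=` G `&` H -> N `<=` sum_set G H ->
  (ncard M * ncard N <= ncard G * ncard H)%N.
Proof.
move=> finG finH sG sH GHM GHN.
rewrite -(ncard_sum_set finG finH sG sH) [leqRHS]mulnC leq_mul ?leq_ncard //.
- exact: finite_setIl.
- exact: finite_sum_set.
Qed.

(** * Cubical chains *)

(** Matrix times vector. The coboundary uses the matrix [bd], the boundary its transpose; finite
    rows make the sums finite for every [f], so infinite chains are allowed. *)
Definition transform (R : comNzRingType) (T : choiceType) (M : T -> T -> R)
    (f : T -> R) : T -> R :=
  fun x => \sum_(y \in [set: T]) f y * M x y.

Definition locally_finite (R : comNzRingType) (T : choiceType)
    (M : T -> T -> R) : Prop :=
  forall x, finite_set [set y | M x y != 0].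

Section Transform.
Variables (R : comNzRingType) (T : choiceType) (M N : T -> T -> R).
Hypotheses (finM : locally_finite M) (finN : locally_finite N).
Implicit Types f g : T -> R.

Lemma transformE (D : set T) f x : finite_set D ->
  [set y | M x y != 0] `<=` D ->
  transform M f x = \sum_(y <- fset_set D) f y * M x y.
Proof.
move=> finD MD; rewrite /transform -fsbig_finite //.
apply/esym/fsbig_widen => // y [_ nDy] /=.
by have [->|/MD //] := eqVneq (M x y) 0; rewrite mulr0.
Qed.

Lemma transformB f g : transform M (f - g) = transform M f - transform M g.
Proof.
apply/funext => x; rewrite /GRing.add /GRing.opp /=.
rewrite !(transformE _ (finM x)) // -sumrB.
by apply: eq_bigr => y _; rewrite -mulrBl.
Qed.

Lemma transform0 : transform M 0 = 0.
Proof. by apply/funext => x; apply: fsbig1 => y _; rewrite mul0r. Qed.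

Lemma eq_transform f g x : (forall y, M x y != 0 -> f y = g y) ->
  transform M f x = transform M g x.
Proof.
move=> fg; apply: eq_fsbigr => y _.
by have [->|/fg ->] := eqVneq (M x y) 0; rewrite ?mulr0.
Qed.

Lemma transform_neq0 f x : transform M f x != 0 ->
  exists y, f y != 0 /\ M x y != 0.
Proof.
apply: contra_neqP => /forallNP H; apply: fsbig1 => y _.
have [->|fy] := eqVneq (f y) 0; first by rewrite mul0r.
have [->|My] := eqVneq (M x y) 0; first by rewrite mulr0.
by case: (H y).
Qed.

Lemma transform_transform f :
  (forall x z, \sum_(y \in [set: T]) M x y * N y z = 0) ->
  transform M (transform N f) = 0.
Proof.
move=> MN; apply/funext => x.
pose D := [set y | M x y != 0].
(* [D] and [E] contain all indices that contribute at [x], so that the two sums are finite and can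
   be exchanged. *)
pose E := \bigcup_(y in D) [set z | N y z != 0].
have finE : finite_set E by apply: bigcup_finite => [|y _]; [exact: finM|exact: finN].
rewrite (@transformE D) //; last exact: finM.
rewrite big_seq_cond (eq_bigr (fun y => \sum_(z <- fset_set E) f z * N y z * M x y)).
  rewrite -big_seq_cond exchange_big /= big1_seq // => z _.
  rewrite (eq_bigr (fun y => f z * (M x y * N y z))); last first.
    by move=> y _; rewrite -mulrA [N y z * _]mulrC.
  rewrite -mulr_sumr -fsbig_finite; last exact: finM.
  rewrite (fsbig_widen D [set: T]) ?MN ?mulr0 // => y [_ /negP].
  by rewrite negbK => /eqP /= ->; rewrite mul0r.
move=> y; rewrite andbT in_fset_set ?inE; last exact: finM.
move=> Dy; rewrite -mulr_suml; congr (_ * _).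
rewrite /transform -fsbig_finite //; apply/esym/fsbig_widen => // z [_ nE] /=.
have [->|Nyz] := eqVneq (N y z) 0; first by rewrite mulr0.
by case: nE; exists y.
Qed.

End Transform.

(** * The cubical boundary matrix *)

Section Boundary.
Variables (d q : nat).
Implicit Types (s t u : cell d).

Lemma bd_neq0 s t : bd q s t != 0 ->
  exists j b, j \in s.2 /\ t = facet s j b.
Proof.
apply: contra_neqP => H; rewrite /bd big1 // => j js.
have nf b : (t == facet s j b) = false.
  by apply/eqP => tE; apply: H; exists j, b.
by rewrite !nf subrr mulr0.
Qed.

Lemma finite_bd s : finite_set [set t | bd q s t != 0].
Proof.
apply: (@sub_finite_set _ _
  ((fun jb => facet s jb.1 jb.2) @` [set: 'I_d * bool])).
  by move=> t /bd_neq0[j [b [_ ->]]]; exists (j, b).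
exact/finite_image/finite_finset.
Qed.

(** A cube is recovered from a facet, its direction and its side, so [t] is a facet of at most 2d
    cubes. This makes boundaries of infinite chains well defined. *)
Lemma finite_cobd t : finite_set [set s | bd q s t != 0].
Proof.
pose cofacet (u : cell d) (jb : 'I_d * bool) : cell d :=
  ([ffun l => u.1 l - (jb.2 && (l == jb.1))%:R], jb.1 |: u.2)%SET.
apply: (@sub_finite_set _ _ (cofacet t @` [set: 'I_d * bool])).
  move=> s /bd_neq0[j [b [js ->]]]; exists (j, b) => //.
  rewrite /cofacet /facet /=; case: s js => s1 s2 /= js; congr pair.
    by apply/ffunP => l; rewrite !ffunE addrK.
  by rewrite finset.setD1K.
exact/finite_image/finite_finset.
Qed.

Lemma bd_dim s t : bd q s t != 0 -> cell_dim s = (cell_dim t).+1.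
Proof.
by move=> /bd_neq0[j [b [js ->]]]; rewrite /cell_dim (cardsD1 j) js.
Qed.

Lemma bd_face s t : bd q s t != 0 -> face t s.
Proof.
move=> /bd_neq0[j [b [js ->]]] l; rewrite /lo /hi /facet /= ffunE !inE.
have [->|_] := eqVneq l j; last by rewrite andbF addr0.
by rewrite js /= andbT; case: b => /=; split; lia.
Qed.

Lemma sum_bd s (g : cell d -> 'Z_q) :
  \sum_(t \in [set: cell d]) bd q s t * g t =
  \sum_(j in s.2) (-1) ^+ #|[set l in s.2 | (l < j)%N]| *
     (g (facet s j true) - g (facet s j false)).
Proof.
pose D := (fun jb => facet s jb.1 jb.2) @` [set: 'I_d * bool].
have finD : finite_set D by exact/finite_image/finite_finset.
rewrite -(fsbig_widen D [set: cell d]) //; last first.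
  move=> t [_ nD] /=; have [->|/bd_neq0[j [b [_ tE]]]] := eqVneq (bd q s t) 0.
    by rewrite mul0r.
  by case: nD; exists (j, b).
rewrite fsbig_finite //.
have delta j b : \sum_(t <- fset_set D) (t == facet s j b)%:R * g t =
    g (facet s j b).
  rewrite (bigD1_seq (facet s j b)) ?fset_uniq //=; last first.
    by rewrite in_fset_set // inE; exists (j, b).
  rewrite eqxx mul1r big1 ?addr0 // => t /negPf ->; exact: mul0r.
under eq_bigr => t _ do rewrite /bd mulr_suml.
rewrite exchange_big; apply: eq_bigr => j _ /=.
rewrite -!delta -sumrB mulr_sumr; apply: eq_bigr => t _.
by rewrite -mulrA mulrBl.
Qed.

(** The ordered pairs [(j, l)] and [(l, j)] of distinct directions cancel. *)
Lemma antisymmetric_sum0 (V : zmodType) (S : {set 'I_d}) (F : 'I_d -> 'I_d -> V) :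
  (forall j l, j \in S -> l \in S -> (j < l)%N -> F j l + F l j = 0) ->
  \sum_(j in S) \sum_(l in (S :\ j)%SET) F j l = 0.
Proof.
move=> F0.
have split j : j \in S -> \sum_(l in (S :\ j)%SET) F j l =
    \sum_(l in S | (j < l)%N) F j l + \sum_(l in S | (l < j)%N) F j l.
  move=> jS; rewrite (bigID (fun l : 'I_d => (j < l)%N)) /=.
  by congr (_ + _); apply: eq_bigl => l; rewrite !inE -val_eqE /=;
    case: (l \in S); case: ltngtP.
rewrite (eq_bigr _ split) big_split /=.
rewrite [X in _ + X](exchange_big_dep (mem S)) /=; last by move=> j l _ /andP[].
rewrite -big_split big1 //= => j jS.
rewrite [X in _ + X](eq_bigl (fun l => (l \in S) && (j < l)%N)); last first.
  by move=> l /=; rewrite jS.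
by rewrite -big_split big1 // => l /andP[lS jl] /=; exact: F0.
Qed.

Lemma facetC s j l b c : facet (facet s j b) l c = facet (facet s l c) j b.
Proof.
rewrite /facet /=; congr pair.
  by apply/ffunP => m; rewrite !ffunE addrAC.
by apply/finset.setP => m; rewrite !inE andbCA.
Qed.

(** Two directions [j < l] can be removed in either order with the same resulting face. Removing [j]
    first lowers the rank of [l] by one, while removing [l] first leaves the rank of [j] unchanged,
    so the signs are opposite. *)
Lemma bd_bd s u : \sum_(t \in [set: cell d]) bd q s t * bd q t u = 0.
Proof.
rewrite sum_bd; pose n (S : {set 'I_d}) (j : 'I_d) := #|[set l in S | (l < j)%N]|.
pose e j l b c : 'Z_q := (u == facet (facet s j b) l c)%:R.
pose F j l : 'Z_q := (-1) ^+ n s.2 j * ((-1) ^+ n (s.2 :\ j)%SET l *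
   ((e j l true true - e j l true false) - (e j l false true - e j l false false))).
rewrite (eq_bigr (fun j => \sum_(l in (s.2 :\ j)%SET) F j l)); last first.
  move=> j js; rewrite /bd -sumrB mulr_sumr; apply: eq_bigr => l _.
  by rewrite /F -mulrBr.
apply: antisymmetric_sum0 => j l js ls jl; rewrite /F.
have -> : n (s.2 :\ l)%SET j = n s.2 j.
  apply: eq_card => m; rewrite !inE -val_eqE /=.
  by case: ltngtP => //= h; rewrite ?andbF //;
    case: (ltngtP m j) => //; rewrite ?andbF //; lia.
have -> : n s.2 l = (n (s.2 :\ j)%SET l).+1.
  rewrite /n (cardsD1 j) !inE js jl /= add1n; congr _.+1.
  by apply: eq_card => m; rewrite !inE andbA.
have eC b c : e l j b c = e j l c b by rewrite /e facetC.
rewrite !eC exprS; ring.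
Qed.

End Boundary.

(** * Chains, cochains and their cosets *)

Section Chains.
Variables (d q : nat).
Implicit Types (X Y P : set (cell d)) (c f : chain d q).

Lemma finite_supported X : finite_set X ->
  finite_set [set c : chain d q | forall s, c s != 0 -> X s].
Proof.
move=> finX; pose K := fset_set X.
pose ext (g : {ffun K -> 'Z_q}) : chain d q :=
  fun s => if insub s is Some u then g u else 0.
apply: (@sub_finite_set _ _ (ext @` setT)); last exact/finite_image/finite_finset.
move=> c cX; exists [ffun u => c (val u)] => //.
apply/funext => s; rewrite /ext; case: insubP => [u _ <-|]; first by rewrite ffunE.
rewrite in_fset_set // notin_setE => nX.
by apply/esym/eqP/negPn/negP => /cX.
Qed.

Lemma finite_chains (k : int) X : finite_set X -> finite_set (@chains d q k X).
Proof.
move=> finX; apply: sub_finite_set (finite_supported finX).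
by move=> c cX s /cX[].
Qed.

Lemma subgroup_chains (k : int) X : subgroup_set (@chains d q k X).
Proof.
split=> [s /eqP[] //|c c' cX cX' s].
have [cs0|/cX //] := eqVneq (c s) 0.
have [cs0'|/cX' //] := eqVneq (c' s) 0.
by rewrite /GRing.add /GRing.opp /= cs0 cs0' subr0 eqxx.
Qed.

Lemma sub_chains (k : int) X Y : X `<=` Y -> @chains d q k X `<=` chains k Y.
Proof. by move=> XY c cX s /cX[/XY]. Qed.

Lemma restrictionB X c c' :
  restriction X (c - c') = restriction X c - restriction X c'.
Proof.
apply/funext => s; rewrite /restriction /patch /GRing.add /GRing.opp /=.
by case: ifP => // _; rewrite subr0.
Qed.

Lemma restriction0 X : restriction X (0 : chain d q) = 0.
Proof. by apply/funext => s; rewrite /restriction /patch; case: ifP. Qed.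

Lemma restriction_in X c s : X s -> restriction X c s = c s.
Proof. by move=> Xs; rewrite /restriction patchT ?inE. Qed.

Lemma restriction_out X c s : ~ X s -> restriction X c s = 0.
Proof. by move=> Xs; rewrite /restriction patchC ?inE. Qed.

Lemma restriction_neq0 X c s : restriction X c s != 0 -> X s /\ c s != 0.
Proof.
rewrite /restriction /patch; case: ifP => [/set_mem Xs cs|_]; first by [].
by rewrite eqxx.
Qed.

Lemma restriction_chains (k : int) X Y c :
  chains k Y c -> chains k (X `&` Y) (restriction X c).
Proof. by move=> cY s /restriction_neq0[Xs /cY[]]. Qed.

Lemma boundaryE c : boundary c = transform (fun t s => bd q s t) c.
Proof. by []. Qed.

Lemma coboundaryE X f : coboundary X f = restriction X (transform (bd q) f).
Proof. by []. Qed.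

Lemma boundaryB c c' : boundary (c - c') = boundary c - boundary c'.
Proof. exact: (transformB (@finite_cobd d q)). Qed.

Lemma boundary0 : boundary (0 : chain d q) = 0.
Proof. exact: transform0. Qed.

Lemma coboundaryB X f f' :
  coboundary X (f - f') = coboundary X f - coboundary X f'.
Proof.
by rewrite !coboundaryE (transformB (@finite_bd d q)) restrictionB.
Qed.

Lemma coboundary0 X : coboundary X (0 : chain d q) = 0.
Proof. by rewrite coboundaryE transform0 restriction0. Qed.

Lemma coboundary_eq0 X f :
  coboundary X f = 0 <-> forall s, X s -> transform (bd q) f s = 0.
Proof.
rewrite coboundaryE; split=> [f0 s Xs|f0].
  by rewrite -(restriction_in _ Xs) f0.
apply/funext => s; have [Xs|nXs] := pselect (X s).
  by rewrite restriction_in // f0.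
by rewrite restriction_out.
Qed.

Lemma boundary_boundary c : boundary (boundary c) = 0.
Proof.
rewrite !boundaryE; apply: transform_transform.
- exact: finite_cobd.
- exact: finite_cobd.
- move=> t s; rewrite -[RHS](bd_bd q s t); apply: eq_fsbigr => u _.
  exact: mulrC.
Qed.

Lemma transform_bd_bd f : transform (bd q) (transform (bd q) f) = 0.
Proof.
by apply: transform_transform (@bd_bd d q); exact: finite_bd.
Qed.

Lemma boundary_chains (k : int) X Y c :
  (forall s t, X s -> bd q s t != 0 -> Y t) ->
  chains (k + 1) X c -> chains k Y (boundary c).
Proof.
move=> XY cX t; rewrite boundaryE => /transform_neq0[s [/cX[Xs ds] bst]].
split; first exact: XY bst.
by move: ds; rewrite (bd_dim bst); lia.
Qed.

Lemma subgroup_cocycles (k : int) X : subgroup_set (@cocycles d q k X).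
Proof.
have sC := subgroup_chains k X.
split; first by split; [exact: sC.1|exact: coboundary0].
move=> f g [fX f0] [gX g0]; split; first exact: sC.2.
by rewrite coboundaryB f0 g0 subr0.
Qed.

Lemma subgroup_BM_cycles (k : int) X : subgroup_set (@BM_cycles d q k X).
Proof.
have sC := subgroup_chains k X.
split; first by split; [exact: sC.1|exact: boundary0].
move=> f g [fX f0] [gX g0]; split; first exact: sC.2.
by rewrite boundaryB f0 g0 subr0.
Qed.

Lemma subgroup_image (V W : zmodType) (u : V -> W) (G : set V) :
  u 0 = 0 -> (forall x y, u (x - y) = u x - u y) ->
  subgroup_set G -> subgroup_set (u @` G).
Proof.
move=> u0 uB [G0 GB]; split; first by exists 0.
by move=> _ _ [x Gx <-] [y Gy <-]; exists (x - y); [exact: GB|].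
Qed.

Lemma subgroup_coboundaries (k : int) X :
  subgroup_set (@coboundaries d q k X).
Proof.
apply: subgroup_image (subgroup_chains _ _); first exact: coboundary0.
exact: coboundaryB.
Qed.

Lemma subgroup_BM_boundaries (k : int) X :
  subgroup_set (@BM_boundaries d q k X).
Proof.
apply: subgroup_image (subgroup_chains _ _); first exact: boundary0.
exact: boundaryB.
Qed.

Lemma chain_coset_eq (B : set (chain d q)) (x y : chain d q) : subgroup_set B ->
  chain_coset B y = chain_coset B x <-> B (y - x).
Proof.
move=> sB; split=> [yx|Byx].
  have : chain_coset B y y by exists 0; rewrite ?addr0 //; exact: sB.1.
  by rewrite yx => -[b Bb <-]; rewrite addrAC subrr add0r.
apply/seteqP; split=> _ [b Bb <-].
  exists (y - x + b); first exact: subgroup_setD.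
  by rewrite addrA [x + _]addrC subrK.
exists (b - (y - x)); first exact: sB.2.
by rewrite opprB addrCA [y + _]addrC subrK addrC.
Qed.

(** Well-definedness of the induced map on quotients: as [u] sends [B] into [C], the choice of
    representative in the coset of [z] is absorbed by [C]. *)
Lemma coset_map_chain_coset (u : chain d q -> chain d q)
    (B C : set (chain d q)) (z : chain d q) :
  subgroup_set B -> subgroup_set C ->
  (forall x y, u (x - y) = u x - u y) -> u @` B `<=` C ->
  coset_map u C (chain_coset B z) = chain_coset C (u z).
Proof.
move=> sB sC uB BC; have u0 : u 0 = 0 by rewrite -[0 in LHS]subr0 uB subrr.
have uD x y : u (x + y) = u x + u y.
  by rewrite -[y in LHS]opprK uB -[- y]sub0r uB u0 sub0r opprK.
apply/seteqP; split=> [_ [_ [b Bb <-] [c Cc <-]]|_ [c Cc <-]].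
  exists (u b + c); last by rewrite uD addrA.
  by apply: subgroup_setD => //; apply: BC; exists b.
exists z; last by exists c.
by exists 0; [exact: sB.1|rewrite addr0].
Qed.

End Chains.

(** * Finite volume *)

Lemma finite_box d (r : box d) : finite_set [set s | in_box r s].
Proof.
(* [n] bounds the side lengths, so positions relative to the lower corner fit in ['I_n.+1]. *)
pose n := \max_j `|upper r j - lower r j|%N.
pose c (x : {ffun 'I_d -> 'I_n.+1} * {set 'I_d}) : cell d :=
  ([ffun j => lower r j + (x.1 j : nat)%:Z], x.2).
apply: (@sub_finite_set _ _ (c @` setT)); last exact/finite_image/finite_finset.
move=> s sr; exists ([ffun j => inord `|s.1 j - lower r j|%N], s.2) => //.
rewrite /c /=; case: s sr => s1 s2 sr /=; congr pair; apply/ffunP => j.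
rewrite !ffunE; have [] := sr j; rewrite /lo /hi /= => h1 h2.
rewrite inordK; first by lia.
rewrite ltnS; apply: leq_trans (leq_bigmax j); move: h2.
case: (j \in s2) => /=; lia.
Qed.

Section Percolation.
Variables (d i : nat) (r : box d).
Hypothesis i_gt0 : (0 < i)%N.
Let X := box_complex i r.
Let Omega := percolation_subcomplexes i X.
Implicit Types (P Q xi : set (cell d)).

Lemma finite_box_complex : finite_set X.
Proof. by apply: sub_finite_set (finite_box r) => s []. Qed.

Lemma percolation_subcomplexesUI P Q : Omega P -> Omega Q ->
  Omega (P `|` Q) /\ Omega (P `&` Q).
Proof.
move=> [[PX Pf] sP Ps] [[QX Qf] sQ Qs]; split; split.
- split; first by move=> s [/PX|/QX].
  by move=> s t [Hs|Hs] ts; [left; exact: Pf ts|right; exact: Qf ts].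
- by move=> s /sP; left.
- by move=> s [/Ps|/Qs].
- split; first by move=> s [/PX].
  by move=> s t [HP HQ] ts; split; [exact: Pf ts|exact: Qf ts].
- by move=> s Xs; split; [exact: sP|exact: sQ].
- by move=> s [/Ps].
Qed.

Lemma percolation_sub P : Omega P -> P `<=` X.
Proof. by case=> -[]. Qed.

Lemma percolation_facet q P s t : Omega P -> P s -> bd q s t != 0 -> P t.
Proof. by move=> [[_ Pf] _ _] Ps /bd_face; exact: Pf. Qed.

Lemma percolation_low P s : Omega P -> (cell_dim s)%:Z = i%:Z - 1 -> X s -> P s.
Proof. by move=> [_ + _] ds Xs; apply; split=> //; lia. Qed.

Lemma percolation_chains q P : Omega P ->
  @chains d q (i%:Z - 1) P = chains (i%:Z - 1) X.
Proof.
move=> OP; apply/seteqP; split; first exact/sub_chains/percolation_sub.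
by move=> c cX s /cX[Xs ds]; split=> //; exact: percolation_low Xs.
Qed.

Lemma with_boundaryS xi P Q : P `<=` Q ->
  with_boundary i r xi P `<=` with_boundary i r xi Q.
Proof. by move=> PQ s [[/PQ|]|]; [left; left|left; right|right]. Qed.

Lemma with_boundaryU xi P Q s :
  with_boundary i r xi (P `|` Q) s -> with_boundary i r xi P s \/ Q s.
Proof.
by move=> [[[?|?]|?]|?]; [left; left; left|right|left; left; right|left; right].
Qed.

Lemma sub_with_boundary xi P : P `<=` with_boundary i r xi P.
Proof. by move=> s; left; left. Qed.

(** * Cohomology: cochains of the box that extend to cocycles *)

Section Cohomology.
Variables (q : nat) (xi : set (cell d)).
Let k : int := i%:Z - 1.
Let Y := with_boundary i r xi.
(** The groups K(P), taken before passing to classes so that all of them are subgroups of one finite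
    group of cochains. *)
Let extendable P : set (chain d q) := restriction X @` cocycles k (Y P).

Lemma restriction_percolation P (f : chain d q) : Omega P ->
  cocycles k (Y P) f -> restriction P f = restriction X f.
Proof.
move=> OP [fY _]; apply/funext => s; have [fs|/fY[_ ds]] := eqVneq (f s) 0.
  by rewrite /restriction /patch fs !if_same.
have [Ps|nPs] := pselect (P s).
  by rewrite !restriction_in //; exact: percolation_sub OP _ _.
by rewrite !restriction_out // => Xs; apply: nPs; exact: percolation_low Xs.
Qed.

(** Coboundaries of degree i - 1 involve only cells of dimension i - 2 and i - 1, which [P] shares
    with the box. *)
Lemma coboundaries_percolation P : Omega P ->
  @coboundaries d q k P = coboundaries k X.
Proof.
move=> OP.
have low s : (cell_dim s)%:Z = k \/ (cell_dim s)%:Z = k - 1 -> P s <-> X s.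
  move=> ds; split; first exact: percolation_sub.
  by move=> Xs; case: OP => [_ + _]; apply; split=> //; rewrite /k in ds; lia.
have chE : @chains d q (k - 1) P = chains (k - 1) X.
  apply/seteqP; split=> c cX s /cX[Xs ds]; split=> //;
    by apply/low => //; right.
rewrite /coboundaries chE; apply: eq_imagel => c cX.
apply/funext => s; rewrite !coboundaryE.
have [fs|/transform_neq0[t [/cX[_ dt] /bd_dim ds]]] :=
    eqVneq (transform (bd q) c s) 0.
  by rewrite /restriction /patch fs !if_same.
have [] := low s; first by left; move: dt; rewrite ds; lia.
move=> PX XP; have [Ps|nPs] := pselect (P s).
  by rewrite !restriction_in //; exact: PX.
by rewrite !restriction_out // => /XP.
Qed.

Lemma card_im_cohomologyE P : Omega P ->
  card_im_cohomology q i r xi P =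
  ncard (chain_coset (@coboundaries d q k X) @` extendable P).
Proof.
move=> OP; congr (ncard _); rewrite /cohomology /chain_quotient.
rewrite /extendable !image_comp.
apply: eq_imagel => z zY /=; rewrite -(restriction_percolation OP zY).
rewrite -(coboundaries_percolation OP) /pullback.
apply: coset_map_chain_coset.
- exact: subgroup_coboundaries.
- exact: subgroup_coboundaries.
- exact: restrictionB.
(* [P] contains the facets of its cells, so on [P] the coboundary commutes with restriction to
   [P]. *)
move=> _ [_ [c cY <-] <-]; exists (restriction P c).
  apply: sub_chains (restriction_chains (X := P) cY); exact: subIsetl.
apply/funext => s; rewrite !coboundaryE; have [Ps|nPs] := pselect (P s); last first.
  by rewrite !restriction_out.
rewrite !restriction_in //; last exact: sub_with_boundary.
apply: eq_transform => t bst; rewrite restriction_in //.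
exact: percolation_facet bst.
Qed.

Lemma subgroup_extendable P : subgroup_set (extendable P).
Proof.
apply: subgroup_image.
- exact: restriction0.
- exact: restrictionB.
- exact: subgroup_cocycles.
Qed.

Lemma finite_extendable P : finite_set (extendable P).
Proof.
apply: sub_finite_set (finite_chains q k finite_box_complex).
move=> _ [c [cY _] <-].
by apply: sub_chains (restriction_chains (X := X) cY); exact: subIsetl.
Qed.

(** The coboundary of the same cochain taken in the whole lattice is an extension, and it is a
    cocycle everywhere. *)
Lemma coboundaries_sub_extendable P : coboundaries k X `<=` extendable P.
Proof.
move=> _ [c cX <-]; exists (transform (bd q) c) => //; split.
  move=> s /transform_neq0[t [/cX[_ dt] /bd_dim ds]].
  have dsk : (cell_dim s)%:Z = k by move: dt; rewrite ds; lia.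
  by split=> //; right; split=> //; rewrite /k in dsk; lia.
by apply/coboundary_eq0 => s _; rewrite transform_bd_bd.
Qed.

(** Each class has as many representatives as there are coboundaries of the box. This factor does
    not depend on [P], so it can be cancelled. *)
Lemma ncard_extendable P : Omega P ->
  ncard (extendable P) =
  (card_im_cohomology q i r xi P * ncard (@coboundaries d q k X))%N.
Proof.
move=> OP; rewrite card_im_cohomologyE //.
have sB := subgroup_coboundaries q k X.
rewrite (@ncard_quotient _ _ (extendable P) (coboundaries k X)
  (chain_coset (coboundaries k X))).
- by rewrite (setIidr (@coboundaries_sub_extendable P)).
- exact: finite_extendable.
- exact: subgroup_extendable.
- by move=> x y _ _; exact: chain_coset_eq.
Qed.

(** More plaquettes impose more cocycle conditions, while the (i-1)-cells of P_xi are always those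
    of the whole lattice. *)
Lemma extendableS P Q : P `<=` Q -> extendable Q `<=` extendable P.
Proof.
move=> PQ _ [f [fY /coboundary_eq0 f0] <-]; exists f => //; split.
  move=> s /fY[_ ds]; split=> //; right; split=> //; rewrite /k in ds; lia.
by apply/coboundary_eq0 => s Ps; apply: f0; exact: with_boundaryS Ps.
Qed.

(** The extensions [f] and [h] may differ off the box, but the cocycle condition on a cell of [Q]
    sees only its facets, which lie in the box, where [f] and [h] agree. So [f] serves for both. *)
Lemma extendableU P Q : Omega P -> Omega Q ->
  extendable P `&` extendable Q `<=` extendable (P `|` Q).
Proof.
move=> OP OQ g [[f [fY /coboundary_eq0 f0] fg] [h [hY /coboundary_eq0 h0] hg]].
exists f => //; split.
  by apply: sub_chains fY; apply: with_boundaryS; exact: subsetUl.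
apply/coboundary_eq0 => s /with_boundaryU[/f0 //|Qs].
rewrite -(h0 s); last exact: sub_with_boundary.
apply: eq_transform => t bst.
have Xt : X t by exact/(percolation_sub OQ)/(percolation_facet OQ Qs bst).
by rewrite -(restriction_in f Xt) fg -hg restriction_in.
Qed.

Lemma card_im_cohomology_supermodular P Q : Omega P -> Omega Q ->
  (card_im_cohomology q i r xi P * card_im_cohomology q i r xi Q <=
   card_im_cohomology q i r xi (P `|` Q) * card_im_cohomology q i r xi (P `&` Q))%N.
Proof.
move=> OP OQ; have [OU OI] := percolation_subcomplexesUI OP OQ.
have B0 : (0 < ncard (@coboundaries d q k X))%N.
  apply: (@ncard_gt0 _ _ 0); last exact: (subgroup_coboundaries q k X).1.
  exact: sub_finite_set (@coboundaries_sub_extendable P) (finite_extendable P).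
have : (ncard (extendable P) * ncard (extendable Q) <=
    ncard (extendable (P `|` Q)) * ncard (extendable (P `&` Q)))%N.
  apply: ncard_mul_le; do ?exact: finite_extendable; do ?exact: subgroup_extendable.
    exact: extendableU.
  move=> _ [f fP [g gQ <-]]; apply: subgroup_setD; first exact: subgroup_extendable.
    by apply: extendableS fP; exact: subIsetl.
  by apply: extendableS gQ; exact: subIsetr.
by rewrite !ncard_extendable // mulnACA [leqRHS]mulnACA leq_pmul2r // muln_gt0 B0.
Qed.

(** * Borel-Moore homology: cycles of the box that bound *)

Let box_cycles : set (chain d q) := BM_cycles k X.
Let bounding P : set (chain d q) := BM_boundaries k (Y P).

Lemma BM_cycles_percolation P : Omega P -> @BM_cycles d q k P = box_cycles.
Proof. by move=> OP; rewrite /box_cycles /BM_cycles percolation_chains. Qed.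

Lemma card_im_BM_homologyE P : Omega P ->
  card_im_BM_homology q i r xi P = ncard (chain_coset (bounding P) @` box_cycles).
Proof.
move=> OP; congr (ncard _); rewrite /BM_homology /chain_quotient image_comp.
rewrite BM_cycles_percolation //; apply: eq_imagel => z zZ /=.
apply: coset_map_chain_coset => //.
- exact: subgroup_BM_boundaries.
- exact: subgroup_BM_boundaries.
move=> _ [_ [c cP <-] <-]; exists c => //; apply: sub_chains cP.
exact: sub_with_boundary.
Qed.

Lemma finite_box_cycles : finite_set box_cycles.
Proof.
by apply: sub_finite_set (finite_chains q k finite_box_complex) => c [].
Qed.

(** The image is the group of cycles of the box modulo those that bound in P_xi. The left side being
    independent of [P], the image is large when few cycles bound. *)
Lemma ncard_box_cycles P : Omega P ->
  ncard box_cycles =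
  (card_im_BM_homology q i r xi P * ncard (box_cycles `&` bounding P))%N.
Proof.
move=> OP; rewrite card_im_BM_homologyE //; apply: ncard_quotient.
- exact: finite_box_cycles.
- exact: subgroup_BM_cycles.
- by move=> x y _ _; apply: chain_coset_eq; exact: subgroup_BM_boundaries.
Qed.

Lemma boundingS P Q : P `<=` Q -> bounding P `<=` bounding Q.
Proof.
by move=> PQ; apply: image_subset; apply: sub_chains; exact: with_boundaryS.
Qed.

(** A chain bounded by [z] is cut into [c1], its part in P_xi, and the rest [c2], carried by [Q].
    The boundary of [c2] lies in the box, hence so does that of [c1], being the difference from [z],
    although [c1] may be infinite. *)
Lemma boundingU P Q : Omega P -> Omega Q ->
  box_cycles `&` bounding (P `|` Q) `<=`
  sum_set (box_cycles `&` bounding P) (box_cycles `&` bounding Q).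
Proof.
move=> OP OQ z [zZ [c cPQ cz]].
pose c1 := restriction (Y P) c; pose c2 := c - c1.
have c1P : chains (k + 1) (Y P) c1.
  by apply: sub_chains (restriction_chains (X := Y P) cPQ); exact: subIsetl.
have c2Q : chains (k + 1) Q c2.
  move=> s; have [YPs|nYPs] := pselect (Y P s).
    by rewrite /c2 /c1 /GRing.add /GRing.opp /= restriction_in // subrr eqxx.
  rewrite /c2 /c1 /GRing.add /GRing.opp /= restriction_out // subr0.
  by move=> /cPQ[/with_boundaryU[]].
have zE : z = boundary c1 + boundary c2.
  by rewrite -cz [boundary c2]boundaryB addrC subrK.
have c2Z : box_cycles (boundary c2).
  split; last exact: boundary_boundary.
  rewrite -(percolation_chains _ OQ); apply: boundary_chains c2Q.
  by move=> s t Qs; exact: percolation_facet.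
exists (boundary c1); last exists (boundary c2); last by rewrite zE.
- split; last by exists c1.
  have -> : boundary c1 = z - boundary c2 by rewrite zE addrK.
  exact: (subgroup_BM_cycles q k X).2.
- split=> //; exists c2 => //; apply: sub_chains c2Q; exact: sub_with_boundary.
Qed.

Lemma card_im_BM_homology_supermodular P Q : Omega P -> Omega Q ->
  (card_im_BM_homology q i r xi P * card_im_BM_homology q i r xi Q <=
   card_im_BM_homology q i r xi (P `|` Q) *
   card_im_BM_homology q i r xi (P `&` Q))%N.
Proof.
move=> OP OQ; have [OU OI] := percolation_subcomplexesUI OP OQ.
pose G P := box_cycles `&` bounding P.
have finG P' : finite_set (G P') by apply: finite_setIl; exact: finite_box_cycles.
have sG P' : subgroup_set (G P').
  by apply: subgroup_setI; [exact: subgroup_BM_cycles|exact: subgroup_BM_boundaries].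
have G0 P' : (0 < ncard (G P'))%N.
  by apply: (@ncard_gt0 _ _ 0) => //; exact: (sG P').1.
have le : (ncard (G (P `&` Q)) * ncard (G (P `|` Q)) <= ncard (G P) * ncard (G Q))%N.
  apply: ncard_mul_ge => //; last exact: boundingU.
  by move=> z [zZ zD]; split; split=> //; apply: boundingS zD;
    [exact: subIsetl|exact: subIsetr].
(* Both sides equal the square of the number of cycles of the box, so the inequality [le] between
   the groups reverses for the images. *)
have E : (card_im_BM_homology q i r xi P * card_im_BM_homology q i r xi Q *
     (ncard (G P) * ncard (G Q)) =
   card_im_BM_homology q i r xi (P `|` Q) * card_im_BM_homology q i r xi (P `&` Q)
     * (ncard (G (P `&` Q)) * ncard (G (P `|` Q))))%N.
  rewrite mulnACA [(ncard (G (P `&` Q)) * _)%N]mulnC [RHS]mulnACA.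
  by rewrite /G -!ncard_box_cycles.
rewrite -(@leq_pmul2r (ncard (G P) * ncard (G Q))%N) ?muln_gt0 ?G0 //.
by rewrite E leq_mul2l le orbT.
Qed.

End Cohomology.

(** * Bernoulli weights and positive association in a box *)

Section Weight.
Variables (R : realType) (p : R).
Hypothesis p01 : 0 <= p <= 1.

Lemma finite_plaquettes P : Omega P -> finite_set (plaquettes i P).
Proof.
move=> OP; apply: sub_finite_set finite_box_complex.
by move=> s [/(percolation_sub OP)].
Qed.

Lemma bernoulli_weight_ge0 P : 0 <= bernoulli_weight p i r P.
Proof.
by case/andP: p01 => p0 p1; rewrite mulr_ge0 ?exprn_ge0 ?subr_ge0.
Qed.

Lemma bernoulli_weight_modular P Q : Omega P -> Omega Q ->
  bernoulli_weight p i r P * bernoulli_weight p i r Q =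
  bernoulli_weight p i r (P `|` Q) * bernoulli_weight p i r (P `&` Q).
Proof.
move=> OP OQ; have [OU OI] := percolation_subcomplexesUI OP OQ.
(* The exponent of [1 - p] is a truncated subtraction; these bounds make it a true one. *)
have le P' : Omega P' ->
    (num_plaquettes i P' <= num_plaquettes i (box_complex i r))%N.
  move=> OP'; apply: leq_ncard; last by move=> s [/(percolation_sub OP')].
  by apply: sub_finite_set finite_box_complex => s [].
have E : (num_plaquettes i (P `|` Q) + num_plaquettes i (P `&` Q) =
          num_plaquettes i P + num_plaquettes i Q)%N.
  rewrite /num_plaquettes -[RHS]cardfsUI.
  rewrite -(fset_setU (finite_plaquettes OP) (finite_plaquettes OQ)).
  rewrite -(fset_setI (finite_plaquettes OP) (finite_plaquettes OQ)).
  congr (_ + _)%N; congr (ncard _); apply/seteqP; split=> s.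
  - by move=> [[Ps|Qs] ds]; [left|right].
  - by move=> [[Ps ds]|[Qs ds]]; split=> //; [left|right].
  - by move=> [[Ps Qs] ds].
  - by move=> [[Ps ds] [Qs _]].
rewrite /bernoulli_weight mulrACA [RHS]mulrACA -!exprD E.
congr (_ * _ ^+ _).
have := le _ OP; have := le _ OQ; have := le _ OU; have := le _ OI; lia.
Qed.

Lemma positively_associated_weight (N : set (cell d) -> nat) :
  (forall P Q, Omega P -> Omega Q -> (N P * N Q <= N (P `|` Q) * N (P `&` Q))%N) ->
  positively_associated Omega setT
    (normalized Omega (fun P => bernoulli_weight p i r P * (N P)%:R)).
Proof.
move=> NS; apply: positively_associated_normalized finite_box_complex _ _ _ _.
- exact: percolation_sub.
- exact: percolation_subcomplexesUI.
- by move=> P _; rewrite mulr_ge0 ?bernoulli_weight_ge0.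
move=> P Q OP OQ; rewrite mulrACA [leRHS]mulrACA bernoulli_weight_modular //.
apply: ler_wpM2l; first by rewrite mulr_ge0 ?bernoulli_weight_ge0.
by rewrite -!natrM ler_nat NS.
Qed.

Lemma positively_associated_prcm q xi :
  positively_associated Omega setT (prcm p q i r xi).
Proof.
by apply: positively_associated_weight; exact: card_im_cohomology_supermodular.
Qed.

Lemma positively_associated_prcm_BM q xi :
  positively_associated Omega setT (prcm_BM p q i r xi).
Proof.
by apply: positively_associated_weight; exact: card_im_BM_homology_supermodular.
Qed.

End Weight.
End Percolation.

(** * Infinite volume *)

(* Closed in the product topology on {0,1}^T. *)
Definition closed_family (T : Type) (F : set (set T)) : Prop :=
  forall P, (forall S, finite_set S -> exists2 P', F P' & P' `&` S = P `&` S) ->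
  F P.

Section Closed.
Variable T : choiceType.
Implicit Types (F G : set (set T)) (P : set T).

Lemma closed_family_bigcap (I : Type) (F : I -> set (set T)) :
  (forall n, closed_family (F n)) -> closed_family (\bigcap_n F n).
Proof.
move=> cF P H n _; apply: cF => S finS.
by have [P' FP' PS] := H S finS; exists P' => //; exact: FP'.
Qed.

(** Finite windows [S1] and [S2] that separate [P] from [F] and from [G] have a union that separates
    [P] from both. *)
Lemma closed_familyU F G :
  closed_family F -> closed_family G -> closed_family (F `|` G).
Proof.
move=> cF cG P H; apply: contrapT => /not_orP[nF nG].
have {nF} [S1 [fin1 nF]] : exists S, finite_set S /\
    ~ exists2 P', F P' & P' `&` S = P `&` S.
  by apply: contrapT => /forallNP h; apply/nF/cF => S finS; apply: contrapT => h';
    apply: (h S).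
have {nG} [S2 [fin2 nG]] : exists S, finite_set S /\
    ~ exists2 P', G P' & P' `&` S = P `&` S.
  by apply: contrapT => /forallNP h; apply/nG/cG => S finS; apply: contrapT => h';
    apply: (h S).
have sub (A C P' : set T) : P' `&` C = P `&` C -> A `<=` C -> P' `&` A = P `&` A.
  by move=> PC subAC; rewrite -(setIidr subAC) !setIA PC.
have [|P' [FP'|GP'] PS] := H (S1 `|` S2); first by rewrite finite_setU.
- by apply: nF; exists P' => //; apply: sub PS _ => // x; left.
- by apply: nG; exists P' => //; apply: sub PS _ => // x; right.
Qed.

Lemma closed_family0 : closed_family (set0 : set (set T)).
Proof. by move=> P /(_ set0 (finite_set0 _))[]. Qed.

Lemma closed_family_depends S F : finite_set S ->
  (forall P P', P `&` S = P' `&` S -> F P -> F P') -> closed_family F.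
Proof. by move=> finS dF P /(_ S finS)[P' FP' PS]; exact: dF FP'. Qed.

(** Outer approximation of the upward closure of [F]: a member of [F] has to lie below [P] only
    inside the window [S], so the event is an increasing cylinder. *)
Definition up_to (S : set T) F : set (set T) :=
  [set P | exists2 P', F P' & P' `&` S `<=` P].

Lemma up_to_depends S F P P' : P `&` S = P' `&` S -> up_to S F P -> up_to S F P'.
Proof.
move=> PS [Q FQ QS]; exists Q => // s [Qs Ss].
have : (P `&` S) s by split=> //; exact: QS.
by rewrite PS => -[].
Qed.

Lemma up_to_mono S F P P' : P `<=` P' -> up_to S F P -> up_to S F P'.
Proof. by move=> PP' [Q FQ QS]; exists Q => // s /QS/PP'. Qed.

Lemma up_to_sub S S' F : S `<=` S' -> up_to S' F `<=` up_to S F.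
Proof. by move=> SS P [Q FQ QS]; exists Q => // s [Qs /SS Ss]; exact: QS. Qed.

(* A limit of witnesses along a free ultrafilter is again a witness. *)
Lemma bigcap_up_to (S : nat -> set T) F : closed_family F ->
  (forall m n, (m <= n)%N -> S m `<=` S n) ->
  \bigcap_n up_to (S n) F `<=` up_to (\bigcup_n S n) F.
Proof.
move=> cF mS P HP.
have /choice[Q FQ] n : exists Q, F Q /\ Q `&` S n `<=` P.
  by have [Q FQ QS] := HP n I; exists Q.
have [G [UG sG]] := ultraFilterLemma (F := \oo) _.
have PG : ProperFilter G by exact: ultra_proper.
have FG : Filter G by exact: _.
(* The pointwise limit of the [Q n] along the ultrafilter [G]. At each [s], hence on each finite
   set, [Q n] agrees with [L] for almost every [n] in the sense of [G]. *)
pose L := [set s | G [set n | Q n s]].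
have agree s : G [set n | Q n s <-> L s].
  have [Ls|nLs] := pselect (L s).
    apply: (@filterS _ _ _ [set n | Q n s]); last exact: Ls.
    by move=> n Qn; split.
  have [//|Gc] := in_ultra_setVsetC [set n | Q n s] UG.
  by apply: filterS Gc => n nQ; split.
exists L; last first.
  move=> s [Ls [m _ Sm]].
  have Gm : G [set n | (m <= n)%N] by apply: sG; exists m.
  have [n [Qn mn]] := filter_ex (@filterI _ G FG _ _ Ls Gm).
  by apply: (FQ n).2; split=> //; exact: mS Sm.
apply: cF => R finR.
have GR : G (\bigcap_(s in R) [set n | Q n s <-> L s]).
  rewrite -(fset_setK finR).
  by apply: filter_bigI => s _; exact: agree.
have [n Qn] := filter_ex GR.
exists (Q n); first exact: (FQ n).1.
by apply/seteqP; split=> s [h Rs]; split=> //; apply/Qn.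
Qed.

End Closed.

Definition initial_segment (T : countType) (n : nat) : set T :=
  [set s : T | (choice.pickle s < n)%N].

Lemma finite_initial_segment (T : countType) n : finite_set (@initial_segment T n).
Proof.
apply: (@sub_finite_set _ _ [set` pmap (@choice.unpickle T) (iota 0 n)])
  => [s /= sn|].
  rewrite mem_pmap; apply/mapP; exists (choice.pickle s);
    last by rewrite choice.pickleK.
  by rewrite mem_iota add0n.
exact: finite_seq.
Qed.

Lemma finite_sub_initial_segment (T : countType) (S : set T) : finite_set S ->
  exists n, S `<=` initial_segment n.
Proof.
move=> finS; exists (\max_(s <- fset_set S) choice.pickle s).+1 => s Ss.
rewrite /initial_segment /= ltnS.
by apply: (@leq_bigmax_seq _ _ xpredT) => //; rewrite in_fset_set // inE.
Qed.

(** * Inner regularity of probability measures on configurations *)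

Section Configurations.
Variable d : nat.
Implicit Types (A F : set (configurations d)) (S : set (cell d)).

(** Such an event is the union of finitely many elementary cylinders [atom T], one for each trace
    [T] on [S] that belongs to it. *)
Lemma measurable_depends S A : finite_set S ->
  (forall P P', P `&` S = P' `&` S -> A P -> A P') ->
  measurable (A : set (configurations d)).
Proof.
move=> finS dA.
pose atom (T : set (cell d)) : set (configurations d) :=
  \bigcap_(s in S) [set P | P s <-> T s].
have -> : A = \bigcup_(T in [set T | T `<=` S /\ A T]) atom T.
  apply/seteqP; split=> [P AP|P [T [TS AT] PT]].
    exists (P `&` S); last by move=> s Ss; split=> [|[]].
    split; first exact: subIsetr.
    by apply: dA AP; rewrite -setIA setIid.
  apply: dA AT; apply/seteqP; split=> s [h Ss]; split=> //; exact/PT.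
apply: fin_bigcup_measurable.
  apply: (@sub_finite_set _ _ (@set_of_subfinset _ (fset_set S) @` setT)).
    move=> T [TS _]; have [x xT] := set_of_subfinset_surj finS TS; by exists x.
  exact/finite_image/finite_finset.
move=> T _; apply: fin_bigcap_measurable => // s _.
have mc : measurable ([set P | P s] : set (configurations d)).
  by apply: sub_sigma_algebra; exists s.
have [Ts|nTs] := pselect (T s).
  rewrite [X in measurable X](_ : _ = [set P | P s]) //.
  by apply/seteqP; split=> P /= h; [exact/h|split].
rewrite [X in measurable X](_ : _ = ~` [set P | P s]); first exact: measurableC.
by apply/seteqP; split=> P /= h; [move=> /h|split].
Qed.

(** There are countably many cells, so agreement on the initial segments, a countable family of
    windows, already tests membership. *)
Lemma measurable_closed_family F : closed_family F ->
  measurable (F : set (configurations d)).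
Proof.
move=> cF; pose S n := @initial_segment (cell d) n.
have -> : F = \bigcap_n [set P | exists2 P', F P' & P' `&` S n = P `&` S n].
  apply/seteqP; split=> [P FP n _|P HP]; first by exists P.
  apply: cF => R /finite_sub_initial_segment[n Rn].
  have [P' FP' PS] := HP n I; exists P' => //.
  by rewrite -(setIidr Rn) !setIA PS.
apply: bigcapT_measurable => n; apply: (@measurable_depends (S n)).
  exact: finite_initial_segment.
by move=> P P' PP' [Q FQ QP]; exists Q; rewrite // QP.
Qed.

Variables (R : realType) (mu : probability (configurations d) R).

Definition inner_regular A : Prop := forall e : R, 0 < e ->
  exists F, [/\ closed_family F, F `<=` A & (mu (A `\` F) <= e%:E)%E].

Lemma inner_regularU A A' : measurable A -> measurable A' ->
  inner_regular A -> inner_regular A' -> inner_regular (A `|` A').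
Proof.
move=> mA mA' iA iA' e e0; have e20 : 0 < e / 2 by rewrite divr_gt0.
have [F [cF FA muF]] := iA _ e20; have [F' [cF' FA' muF']] := iA' _ e20.
have mF := measurable_closed_family cF; have mF' := measurable_closed_family cF'.
exists (F `|` F'); split; [exact: closed_familyU|exact: setUSS|].
have mD : measurable (A `\` F) by exact: measurableD.
have mD' : measurable (A' `\` F') by exact: measurableD.
apply: (@le_trans _ _ (mu ((A `\` F) `|` (A' `\` F')))).
  apply: le_measure; rewrite ?inE.
  - by apply: measurableD; exact: measurableU.
  - exact: measurableU.
  - by move=> P [[AP|AP] /not_orP[nF nF']]; [left|right].
apply: (le_trans (measureU2 _ _ _)) => //.
by rewrite [e]splitr EFinD leeD.
Qed.

Lemma inner_regular_bigcap (A : nat -> set (configurations d)) :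
  (forall n, measurable (A n)) -> (forall n, inner_regular (A n)) ->
  inner_regular (\bigcap_n A n).
Proof.
move=> mA iA e e0.
(* The errors e / 2^(n+1) add up to [e]. *)
have /choice[F HF] n : exists F, [/\ closed_family F, F `<=` A n &
    (mu (A n `\` F) <= (e / (2 ^ n.+1)%:R)%:E)%E].
  by apply: iA; rewrite divr_gt0 // ltr0n expn_gt0.
have mF n : measurable (F n) by apply: measurable_closed_family; case: (HF n).
exists (\bigcap_n F n); split.
- by apply: closed_family_bigcap => n; case: (HF n).
- by move=> P FP n _; have [_ + _] := HF n; apply; exact: FP.
have mD n : measurable (A n `\` F n) by exact: measurableD.
apply: (@le_trans _ _ (\sum_(n <oo) mu (A n `\` F n))%E).
  apply: measure_sigma_subadditive => //.
    by apply: measurableD; exact: bigcapT_measurable.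
  move=> P [AP /existsNP[n nF]]; exists n => //; split; first exact: AP.
  by move=> FP; apply: nF.
apply: le_trans (epsilon_trick0 xpredT (ltW e0)).
by apply: lee_nneseries => n _ //; case: (HF n).
Qed.

(** Only finite unions of closed families are closed. Continuity from above therefore first replaces
    the union by a finite one at cost [e / 2], and the other half is spent on approximating that. *)
Lemma inner_regular_bigcup (A : nat -> set (configurations d)) :
  (forall n, measurable (A n)) -> (forall n, inner_regular (A n)) ->
  inner_regular (\bigcup_n A n).
Proof.
move=> mA iA e e0; have e20 : 0 < e / 2 by rewrite divr_gt0.
pose B n := \bigcup_(k in `I_n) A k; pose A' := \bigcup_n A n.
have mA' : measurable A' by exact: bigcupT_measurable.
have mB n : measurable (B n).
  by apply: fin_bigcup_measurable; [exact: finite_II|move=> k _; exact: mA].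
have mD n : measurable (A' `\` B n) by exact: measurableD.
have iB n : inner_regular (B n).
  elim: n => [|n IHn].
    rewrite /B II0 bigcup_set0 => e' e'0; exists set0; split=> //.
      exact: closed_family0.
    by rewrite setD0 measure0 lee_fin ltW.
  have -> : B n.+1 = B n `|` A n by rewrite /B IIS bigcup_setU bigcup_set1.
  exact: inner_regularU (mB n) (mA n) IHn (iA n).
have cap0 : \bigcap_n (A' `\` B n) = set0.
  apply/seteqP; split=> // P HP; have [[k _ Ak] _] := HP 0%N I.
  by have [_] := HP k.+1 I; apply; exists k => //=.
have cvg0 : mu \o (fun n => A' `\` B n) @ \oo --> (0 : \bar R)%E.
  rewrite -(measure0 mu) -cap0; apply: nonincreasing_cvg_mu => //.
  - by rewrite (le_lt_trans (probability_le1 mu _)) ?ltry.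
  - by rewrite cap0.
  - move=> m n mn; apply/subsetPset => P [AP nB]; split=> // -[k km Ak].
    by apply: nB; exists k => //; exact: leq_trans km mn.
have [n muD] : exists n, (mu (A' `\` B n) <= (e / 2)%:E)%E.
  apply: contrapT => /forallNP h.
  have : ((e / 2)%:E <= 0 :> \bar R)%E.
    apply: cvge_to_ge cvg0 _; near=> n; rewrite ltW // ltNge.
    exact/negP/h.
  by rewrite lee_fin leNgt e20.
have [F [cF FB muF]] := iB n _ e20.
have mF := measurable_closed_family cF.
have mDF : measurable (B n `\` F) by exact: measurableD.
exists F; split=> //; first by move=> P /FB[k _ Ak]; exists k.
apply: (@le_trans _ _ (mu ((A' `\` B n) `|` (B n `\` F)))).
  apply: le_measure; rewrite ?inE.
  - exact: measurableD.
  - exact: measurableU.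
  - by move=> P [AP nF]; have [BP|nB] := pselect (B n P); [right|left].
apply: (le_trans (measureU2 _ _ _)) => //.
by rewrite [e]splitr EFinD leeD.
Unshelve. all: by end_near. Qed.

Lemma inner_regular_depends S A : finite_set S ->
  (forall P P', P `&` S = P' `&` S -> A P -> A P') -> inner_regular A.
Proof.
move=> finS dA e e0; exists A; split=> //; first exact: closed_family_depends dA.
by rewrite setDv measure0 lee_fin ltW.
Qed.

(** The events that are inner regular along with their complements form a sigma-algebra. It contains
    the generators, since these and their complements depend on one cell. *)
Lemma measurable_inner_regular A : measurable A -> inner_regular A.
Proof.
pose M := [set A | [/\ measurable A, inner_regular A & inner_regular (~` A)]].
suff sM : @measurable _ (configurations d) `<=` M by move=> /sM[].
apply: smallest_sub; last first.
  move=> _ [s _ <-].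
  have dep (P P' : set (cell d)) : P `&` [set s] = P' `&` [set s] -> P s <-> P' s.
    move=> E; have : (P `&` [set s]) s <-> (P' `&` [set s]) s by rewrite E.
    by move=> [h h']; split=> Ps; [case: h|case: h'].
  split; first by apply: sub_sigma_algebra; exists s.
    apply: (@inner_regular_depends [set s]) => // P P' PP'.
    exact: (dep _ _ PP').1.
  apply: (@inner_regular_depends [set s]) => // P P' PP'.
  by apply: contra_not => P's; exact: (dep _ _ PP').2.
split.
- split=> //; first exact: (@inner_regular_depends set0).
  by rewrite setC0; exact: (@inner_regular_depends set0).
- move=> B [mB iB iBC]; rewrite setTD; split=> //; first exact: measurableC.
  by rewrite setCK.
- move=> B HB; split.
  + by apply: bigcupT_measurable => n; case: (HB n).
  + by apply: inner_regular_bigcup => n; case: (HB n).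
  + rewrite setC_bigcup; apply: inner_regular_bigcap => n; case: (HB n) => // *.
    exact: measurableC.
Qed.

End Configurations.

Definition upward_closed (T : Type) (A : set (set T)) : Prop :=
  forall P P', P `<=` P' -> A P -> A P'.

Lemma normalizedI (R : realType) (T : choiceType) (Omega : set T) (w : T -> R) A :
  normalized Omega w (Omega `&` A) = normalized Omega w A.
Proof. by rewrite /normalized setIA setIid. Qed.

(** The sample space changes with the box, whereas an event closed upwards among all sets of cells
    is increasing in each of them once cut down to [Omega]. *)
Lemma positively_associated_upward_closed (R : realType) d
    (Omega : set (set (cell d))) (w : set (cell d) -> R) A B :
  positively_associated Omega setT (normalized Omega w) ->
  upward_closed A -> upward_closed B ->
  (normalized Omega w A * normalized Omega w B <=
   normalized Omega w (A `&` B))%E.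
Proof.
move=> PA uA uB; rewrite -(normalizedI Omega w A).
rewrite -(normalizedI Omega w B) -(normalizedI Omega w (A `&` B)) setIIr.
apply: PA => //; try exact: subIsetl.
- by move=> P P' [_ AP] OP' PP'; split=> //; exact: uA AP.
- by move=> P P' [_ BP] OP' PP'; split=> //; exact: uB BP.
Qed.

(** Each defining condition concerns one cell, or a cell and a face of it, so a finite window
    detects its failure. *)
Lemma closed_family_percolation d i :
  closed_family (percolation_subcomplexes i [set: cell d]).
Proof.
move=> P H; have sub1 (P' : set (cell d)) (s : cell d) (S : set (cell d)) :
    P' `&` S = P `&` S -> S s -> P' s <-> P s.
  move=> PS Ss; have : (P' `&` S) s <-> (P `&` S) s by rewrite PS.
  by move=> [h h']; split=> Ps; [case: h|case: h'].
split.
- split=> // s t Ps ts.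
  have [|P' [[_ Pf] _ _] PS] := H [set s; t]; first exact: finite_set2.
  apply/(sub1 _ t _ PS); first by right.
  by apply: Pf ts; apply/(sub1 _ s _ PS) => //; left.
- move=> s sk; have [|P' [_ P'sk _] PS] := H [set s]; first exact: finite_set1.
  by apply/(sub1 _ s _ PS) => //; exact: P'sk.
- move=> s Ps; have [|P' [_ _ P'sk] PS] := H [set s]; first exact: finite_set1.
  by apply: P'sk; apply/(sub1 _ s _ PS).
Qed.

(** Cells of dimension below i belong to every percolation subcomplex, so inclusion is decided by
    the i-plaquettes, the only cells that cylinder events see. *)
Lemma percolation_le d i (P P' : set (cell d)) : (0 < i)%N ->
  percolation_subcomplexes i setT P -> percolation_subcomplexes i setT P' ->
  P `&` plaquettes i setT `<=` P' -> P `<=` P'.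
Proof.
move=> i0 [_ _ Psk] [_ skP' _] PP' s Ps; have [_] := Psk _ Ps.
rewrite leq_eqVlt => /orP[/eqP ds|lt]; first exact: PP'.
by apply: skP'; split=> //; lia.
Qed.

(** * Positive association of weak limits *)

Section Limit.
Variables (R : realType) (d i : nat).
Hypothesis i_gt0 : (0 < i)%N.
Variables (nu : nat -> set (set (cell d)) -> \bar R).
Variables (mu : probability (configurations d) R).
Hypothesis nu_mu : weak_limit i nu mu.
Hypothesis nuPA : forall n A B, upward_closed A -> upward_closed B ->
  (nu n A * nu n B <= nu n (A `&` B))%E.
Let Omega := percolation_subcomplexes i [set: cell d].
Implicit Types A B F G : set (configurations d).

Lemma weak_limit_upward_closed (S : set (cell d)) A B :
  finite_set S -> S `<=` plaquettes i setT ->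
  (forall P P', P `&` S = P' `&` S -> A P -> A P') ->
  (forall P P', P `&` S = P' `&` S -> B P -> B P') ->
  upward_closed A -> upward_closed B -> (mu A * mu B <= mu (A `&` B))%E.
Proof.
move=> finS Spl dA dB uA uB.
have cA : nu n A @[n --> \oo] --> mu A by apply: nu_mu.2; exists S.
have cB : nu n B @[n --> \oo] --> mu B by apply: nu_mu.2; exists S.
have cAB : nu n (A `&` B) @[n --> \oo] --> mu (A `&` B).
  apply: nu_mu.2; exists S; split=> // P P' PP' [AP BP].
  by split; [exact: dA AP|exact: dB BP].
have mA := measurable_depends finS dA; have mB := measurable_depends finS dB.
apply: lee_cvg_to cAB _.
  by apply: cvgeM cA cB; apply: mule_def_fin; exact: fin_num_measure.
by apply: nearW => n; exact: nuPA.
Qed.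

Let S n : set (cell d) := plaquettes i setT `&` initial_segment n.

Lemma weak_limit_closed_family A B F G :
  measurable A -> measurable B -> A `<=` Omega -> B `<=` Omega ->
  increasing Omega A -> increasing Omega B ->
  closed_family F -> closed_family G -> F `<=` A -> G `<=` B ->
  (mu F * mu G <= mu (A `&` B))%E.
Proof.
move=> mA mB AO BO iA iB cF cG FA GB.
have finS n : finite_set (S n) by apply: finite_setIr; exact: finite_initial_segment.
have mS m n : (m <= n)%N -> S m `<=` S n.
  by move=> mn s [ps sm]; split=> //; exact: leq_trans sm mn.
have capS : \bigcup_n S n = plaquettes i setT.
  apply/seteqP; split=> [s [n _ []]//|s ps].
  by exists (choice.pickle s).+1 => //; split=> //; exact: ltnSn.
pose C n := up_to (S n) F : set (configurations d).
pose D n := up_to (S n) G : set (configurations d).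
have mup n (H : set (configurations d)) :
    measurable (up_to (S n) H : set (configurations d)).
  by apply: measurable_depends (finS n) _; exact: up_to_depends.
have mFC n : (mu F <= mu (C n))%E.
  apply: le_measure; rewrite ?inE; [exact: measurable_closed_family|exact: mup|].
  by move=> P FP; exists P => //; exact: subIsetl.
have mGD n : (mu G <= mu (D n))%E.
  apply: le_measure; rewrite ?inE; [exact: measurable_closed_family|exact: mup|].
  by move=> P GP; exists P => //; exact: subIsetl.
have le n : (mu F * mu G <= mu (C n `&` D n))%E.
  apply: (@le_trans _ _ (mu (C n) * mu (D n))%E); first exact: lee_pmul.
  apply: (@weak_limit_upward_closed (S n)) => //; try exact: subIsetl;
    by [exact: up_to_depends|exact: up_to_mono].
have mCD n : measurable (C n `&` D n) by apply: measurableI; exact: mup.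
have mcap : measurable (\bigcap_n (C n `&` D n)) by exact: bigcapT_measurable.
have cvgCD : mu \o (fun n => C n `&` D n) @ \oo --> mu (\bigcap_n (C n `&` D n)).
  apply: nonincreasing_cvg_mu => //.
    by rewrite (le_lt_trans (probability_le1 mu _)) ?ltry.
  move=> m n mn; apply/subsetPset; apply: setISS; apply: up_to_sub; exact: mS.
have le_cap : (mu F * mu G <= mu (\bigcap_n (C n `&` D n)))%E.
  by apply: cvge_to_ge cvgCD _; apply: nearW.
have mO : measurable (Omega : set (configurations d)).
  by apply: measurable_closed_family; exact: closed_family_percolation.
have muOC : mu (~` Omega) = 0%E.
  by rewrite probability_setC // nu_mu.1 subee.
apply: (le_trans le_cap).
(* Comparing plaquettes gives inclusion only between percolation subcomplexes, so the complement of
   [Omega], a null set, is added. *)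
apply: (@le_trans _ _ (mu ((A `&` B) `|` ~` Omega))).
  apply: le_measure; rewrite ?inE //.
    by apply: measurableU; [exact: measurableI|exact: measurableC].
  move=> P HP; have [OP|] := pselect (Omega P); last by right.
  left; split.
    have [|Q FQ QP] := @bigcap_up_to _ S F cF mS P;
      first by move=> n _; have [] := HP n I.
    rewrite capS in QP; have AQ := FA _ FQ.
    exact: iA AQ OP (percolation_le i_gt0 (AO _ AQ) OP QP).
  have [|Q GQ QP] := @bigcap_up_to _ S G cG mS P;
      first by move=> n _; have [] := HP n I.
  rewrite capS in QP; have BQ := GB _ GQ.
  exact: iB BQ OP (percolation_le i_gt0 (BO _ BQ) OP QP).
apply: (le_trans (measureU2 _ _ _)); [exact: measurableI|exact: measurableC|].
by rewrite [X in (_ + X)%E]muOC adde0.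
Qed.

Lemma positively_associated_weak_limit :
  positively_associated Omega (@measurable _ (configurations d)) mu.
Proof.
move=> A B mA mB AO BO iA iB.
(* All measures are turned into reals in [0, 1], for the final estimate in real arithmetic. *)
have fin H : measurable H -> mu H = (fine (mu H))%:E.
  by move=> mH; rewrite fineK // fin_num_measure.
rewrite (fin _ mA) (fin _ mB) (fin _ (measurableI _ _ mA mB)) -EFinM lee_fin.
have le1 H : measurable H -> 0 <= fine (mu H) <= 1.
  by move=> mH; rewrite fine_ge0 //= -lee_fin -fin // probability_le1.
have inner H e : measurable H -> 0 < e -> exists F,
    [/\ closed_family F, F `<=` H & fine (mu H) <= fine (mu F) + e].
  move=> mH e0; have [F [cF FH muF]] := measurable_inner_regular mu mH e0.
  have mF := measurable_closed_family cF.
  exists F; split=> //; rewrite -lee_fin EFinD -!fin //.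
  have -> : H = F `|` (H `\` F) by rewrite setDUK.
  apply: (le_trans (measureU2 _ _ _)) => //; first exact: measurableD.
  exact: leeD2l.
apply/ler_addgt0Pr => e e0; have e20 : 0 < e / 2 by rewrite divr_gt0.
have [F [cF FA aF]] := inner _ _ mA e20; have [G [cG GB bG]] := inner _ _ mB e20.
have mF := measurable_closed_family cF; have mG := measurable_closed_family cG.
have := weak_limit_closed_family mA mB AO BO iA iB cF cG FA GB.
rewrite (fin _ mF) (fin _ mG) (fin _ (measurableI _ _ mA mB)) -EFinM lee_fin /=.
have := le1 _ mA; have := le1 _ mB; have := le1 _ mF; have := le1 _ mG.
move: (fine (mu (A `&` B))) (fine (mu A)) (fine (mu B))
  (fine (mu F)) (fine (mu G)) aF bG => /=.
move=> c a b f g af bg /andP[g0 g1] /andP[f0 f1] /andP[b0 b1] /andP[a0 a1] fgc.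
(* a b <= (f + e/2) b <= f b + e/2 <= f (g + e/2) + e/2 *)
have h1 : 0 <= (f + e / 2 - a) * b by rewrite mulr_ge0 // subr_ge0.
have h2 : 0 <= f * (g + e / 2 - b) by rewrite mulr_ge0 // subr_ge0.
have h3 : 0 <= e / 2 * (1 - b) by rewrite mulr_ge0 ?(ltW e20) // subr_ge0.
have h4 : 0 <= e / 2 * (1 - f) by rewrite mulr_ge0 ?(ltW e20) // subr_ge0.
nra.
Qed.

End Limit.

Theorem corollary25 (R : realType) (d i q : nat) (p : R)
    (hid : (1 <= i <= d)%N) (hq : (2 <= q)%N) (hp : 0 <= p <= 1) :
  (forall (r : box d) (xi : set (cell d)),
     xi `<=` plaquettes i [set: cell d] ->
     let Omega := percolation_subcomplexes i (box_complex i r) in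
     positively_associated Omega setT (prcm p q i r xi) /\
     positively_associated Omega setT (prcm_BM p q i r xi)) /\
  (forall (r : nat -> box d) (xi : nat -> set (cell d))
     (nu : nat -> set (set (cell d)) -> \bar R)
     (mu : probability (configurations d) R),
     increasing_to_Zd r ->
     (forall n, xi n `<=` plaquettes i [set: cell d]) ->
     (forall n, nu n = prcm p q i (r n) (xi n) \/
                nu n = prcm_BM p q i (r n) (xi n)) ->
     weak_limit i nu mu ->
     positively_associated (percolation_subcomplexes i [set: cell d])
       (@measurable _ (configurations d)) mu).
Proof.
have i_gt0 : (0 < i)%N by case/andP: hid.
split=> [r xi _ Omega|r xi nu mu _ _ nuE nu_mu].
  by split; [exact: positively_associated_prcm|exact: positively_associated_prcm_BM].
apply: positively_associated_weak_limit nu_mu _ => // n A B uA uB.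
have [->|->] := nuE n; apply: positively_associated_upward_closed => //.
- exact: positively_associated_prcm.
- exact: positively_associated_prcm_BM.
Qed.
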